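(* For every $w\in S_\infty$, the coefficients $c^F_w(\mathbf t)\in\mathbb Z[\mathbf t]$ in the expansion $$\mathfrak S_w(\mathbf x;\mathbf t)=\sum_F c^F_w(\mathbf t)\,\mathfrak P_F(\mathbf x;\mathbf t)$$ are Graham-positive, i.e. lie in $\mathbb Z_{\ge0}[t_2-t_1,t_3-t_2,\dots]$.
   Context: $\mathbf x=(x_1,x_2,\dots)$, $\mathbf t=(t_1,t_2,\dots)$. $S_\infty$ is the group of permutations of $\mathbb N$ fixing all but finitely many elements, acting on $\mathbb Z[\mathbf t][\mathbf x]$ by permuting the $x$-variables; $s_i=(i,i+1)$, $\partial_if=(f-s_if)/(x_i-x_{i+1})$. Double Schubert polynomials $\mathfrak S_w$: the unique homogeneous family ($\deg x_i=\deg t_i=1$) with $\mathfrak S_w(\mathbf t;\mathbf t)=\delta_{w,\mathrm{id}}$ and $\partial_i\mathfrak S_w=\mathfrak S_{ws_i}$ if $\ell(ws_i)<\ell(w)$, else $0$. Indexed forests: sequences $F=(T_1,T_2,\dots)$ of binary plane trees (each node a leaf or an internal node with ordered left/right children), all but finitely many one-node trees; leaves identified with $\mathbb N$ left to right; $\emptyset$ has no internal nodes. $\rho_F(v)$: leaf reached from internal node $v$ going repeatedly to left children; terminal: both children leaves; $\mathrm{Qdes}(F)=\{\rho_F(v):v\text{ terminal}\}$; $F/i$ deletes the terminal node with $\rho_F(v)=i$ (replacing it and its leaves by one leaf, relabeling). Double forest polynomials: $R_i^-f=f(x_1,\dots,x_{i-1},t_i,x_i,\dots;\mathbf t)$, $R_i^+f=f(x_1,\dots,x_i,t_i,x_{i+1},\dots;\mathbf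 t)$, $E_if=(R_i^+f-R_i^-f)/(x_i-t_i)$; $\mathfrak P_F$ is the unique homogeneous family with $\mathfrak P_F(\mathbf t;\mathbf t)=\delta_{F,\emptyset}$ and $E_i\mathfrak P_F=\mathfrak P_{F/i}(\mathbf x;\widehat{\mathbf t}_i)$ if $i\in\mathrm{Qdes}(F)$, else $0$, $\widehat{\mathbf t}_i=(t_1,\dots,t_{i-1},t_{i+1},\dots)$. These form a $\mathbb Z[\mathbf t]$-basis of $\mathbb Z[\mathbf t][\mathbf x]$. *)

(* Defs.v *)
From HB Require Import structures.
From mathcomp Require Import all_boot all_order all_algebra.
From mathcomp Require Import finmap.
From mathcomp.multinomials Require Import monalg.
From Stdlib Require List.

Set Implicit Arguments.
Unset Strict Implicit.
Unset Printing Implicit Defensive.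

Import GRing.Theory Num.Theory.
Local Open Scope fset_scope.
Local Open Scope ring_scope.

(* Variables are indexed 0-based:  inl i  is x_{i+1},  inr i is t_{i+1}. *)
Definition var := (nat + nat)%type.
Definition dpoly := {malg int[cmonom var]}.

Definition X (i : nat) : dpoly := << ucm (inl i : var) >>.
Definition T (i : nat) : dpoly := << ucm (inr i : var) >>.

Definition subst (sigma : var -> dpoly) (p : dpoly) : dpoly :=
  mmap (fun c : int => c%:MP)
       (fun m : cmonom var => \prod_(v <- finsupp m) sigma v ^+ m v) p.

Definition homogeneous (p : dpoly) : Prop :=
  exists d : nat, forall m, m \in msupp p -> mdeg m = d.

Definition in_Zt (p : dpoly) : Prop :=
  forall m, m \in msupp p -> forall i : nat, m (inl i) = 0%N.

Definition at_tt (p : dpoly) : dpoly :=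
  subst (fun v => match v with inl i => T i | inr i => T i end) p.

(* S_infinity : finitely supported injective maps nat -> nat (0-based:  *)
(* the paper's integer k is our k-1).                                  *)
Definition perm_inf := {fsfun nat -> nat}.
Definition is_perm_inf (w : perm_inf) : bool := fsinjectiveb w.

(* s_i = (i, i+1) (0-based; paper's s_{i+1}) *)
Definition s_ (i : nat) : perm_inf := [fsfun [fsfun] with i |-> i.+1, i.+1 |-> i].

Definition mul_s (w : perm_inf) (i : nat) : perm_inf := fsfun_comp w (s_ i).

(* length = number of inversions; all inversions lie below the bound *)
Definition perm_bound (w : perm_inf) : nat := (\max_(k <- finsupp w) k).+1.
Definition perm_length (w : perm_inf) : nat :=
  \sum_(j < perm_bound w) \sum_(i < j) (w j < w i)%N.

Definition swapx (i : nat) (p : dpoly) : dpoly :=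
  subst (fun v => match v with
                  | inl j => if j == i then X i.+1 else if j == i.+1 then X i else X j
                  | inr j => T j end) p.

(* Defining properties of the double Schubert polynomials.  The equation
   (x_i - x_{i+1}) * g = f - s_i f  is the definition of  g = partial_i f. *)
Definition schubert_family (S : perm_inf -> dpoly) : Prop :=
  forall w : perm_inf, is_perm_inf w ->
    [/\ homogeneous (S w),
        at_tt (S w) = (if w == [fsfun] then 1 else 0) &
        forall i : nat,
          if (perm_length (mul_s w i) < perm_length w)%N
          then (X i - X i.+1) * S (mul_s w i) = S w - swapx i (S w)
          else S w - swapx i (S w) = 0].

Inductive tree : Type := Leaf | Node of tree & tree.

Fixpoint nleaves (t : tree) : nat :=
  match t with Leaf => 1 | Node l r => nleaves l + nleaves r end.

(* A forest (T_1, T_2, ...) is represented by the finite list of its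
   trees up to the last non-trivial one (all further trees are leaves). *)
Definition forest := seq tree.

Fixpoint drop_leaves (F : forest) : forest :=
  match F with Leaf :: F' => drop_leaves F' | _ => F end.
Definition strip (F : forest) : forest := rev (drop_leaves (rev F)).
Definition canon (F : forest) : Prop := strip F = F.

(* Leaves are numbered 0,1,2,... left to right (paper: 1,2,3,...).
   off = number of the leftmost leaf of the (sub)tree. *)
Fixpoint tqdes (off : nat) (t : tree) : seq nat :=
  match t with
  | Leaf => [::]
  | Node Leaf Leaf => [:: off]
  | Node l r => tqdes off l ++ tqdes (off + nleaves l) r
  end.

Fixpoint fqdes (off : nat) (F : forest) : seq nat :=
  match F with
  | [::] => [::]
  | t :: F' => tqdes off t ++ fqdes (off + nleaves t) F'
  end.

(* Qdes(F) = { rho_F(v) : v terminal } *)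
Definition Qdes (F : forest) : seq nat := fqdes 0 F.

Fixpoint tdel (off i : nat) (t : tree) : tree :=
  match t with
  | Leaf => Leaf
  | Node Leaf Leaf => if off == i then Leaf else t
  | Node l r => Node (tdel off i l) (tdel (off + nleaves l) i r)
  end.

Fixpoint fdel (off i : nat) (F : forest) : forest :=
  match F with
  | [::] => [::]
  | t :: F' => tdel off i t :: fdel (off + nleaves t) i F'
  end.

Definition fquot (F : forest) (i : nat) : forest := strip (fdel 0 i F).

Definition Rminus (i : nat) (p : dpoly) : dpoly :=
  subst (fun v => match v with
                  | inl j => if (j < i)%N then X j else if j == i then T i else X j.-1
                  | inr j => T j end) p.

Definition Rplus (i : nat) (p : dpoly) : dpoly :=
  subst (fun v => match v with
                  | inl j => if (j <= i)%N then X j else if j == i.+1 then T i else X j.-1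
                  | inr j => T j end) p.

Definition hat_t (i : nat) (p : dpoly) : dpoly :=
  subst (fun v => match v with
                  | inl j => X j
                  | inr j => if (j < i)%N then T j else T j.+1 end) p.

(* Defining properties of the double forest polynomials. The equation
   (x_i - t_i) * g = R_i^+ f - R_i^- f  is the definition of  g = E_i f. *)
Definition forest_family (P : forest -> dpoly) : Prop :=
  forall F : forest, canon F ->
    [/\ homogeneous (P F),
        at_tt (P F) = (if F is [::] then 1 else 0) &
        forall i : nat,
          if i \in Qdes F
          then (X i - T i) * hat_t i (P (fquot F i)) = Rplus i (P F) - Rminus i (P F)
          else Rplus i (P F) - Rminus i (P F) = 0].

Definition graham_positive (c : dpoly) : Prop :=
  exists q : {malg int[cmonom nat]},
    (forall m, 0 <= q@_m) /\
    c = mmap (fun a : int => a%:MP)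
             (fun m : cmonom nat => \prod_(k <- finsupp m) (T k.+1 - T k) ^+ m k) q.

Definition expansion (P : forest -> dpoly) (f : dpoly) (fs : seq forest)
  (c : forest -> dpoly) : Prop :=
  [/\ List.NoDup fs, (forall F, List.In F fs -> canon F /\ in_Zt (c F)) &
      f = \sum_(F <- fs) c F * P F].

(* Main.v *)
Require Import Defs.
From HB Require Import structures.
From mathcomp Require Import all_boot all_order all_algebra.
From mathcomp Require Import finmap.
From mathcomp Require Import ring zify.
From mathcomp.multinomials Require Import monalg.

(** Write [dd a b] for the divided difference along the transposition of [x_a]
and [x_b].  Attaching to each internal node of a forest [F] the operator
[dd a b], with [a] and [b] the last leaves of its left and right subtrees,
and composing them with ancestors to the left, gives an operator [DF F] such
that [f |-> (DF F f)(t;t)] is dual to the double forest polynomials: trimming a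
terminal node at leaf [i] turns [DF F] into [DF (F/i)] applied to
[R_i^- (dd i (i+1) f) = E_i f].  So the coefficient of [P_F] in [S_w] is
[(DF F S_w)(t;t)].

It remains to write [DF F] as a sum of products of simple divided differences
with coefficients in [N[x_2 - x_1, x_3 - x_2, ...]], because products of simple
divided differences map [S_w] to [0] or to another [S_v], and [S_v(t;t)] is [0] or [1].
By induction on [F] this reduces to lifting a product of simple divided
differences through [R_i^-].  Every simple one lifts to a simple one, except
[dd (i-1) i], which lifts to
  [dd (i-1) (i+1) = d + d' + b d d' + b' d' d + b b' d d' d],
where [d = dd (i-1) i], [d' = dd i (i+1)], [b = x_i - x_{i-1}], [b' = x_{i+1} - x_i].
Bringing the product into a Grassmannian normal form first, these coefficients
can be moved to the left of all divided differences without ever creating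
a sign. *)

Set Implicit Arguments.
Unset Strict Implicit.
Unset Printing Implicit Defensive.

Import GRing.Theory Num.Theory.
Local Open Scope fset_scope.
Local Open Scope ring_scope.

(** * Substitutions in monoid algebras *)

Section Substitution.
Variables (I : choiceType) (S : comNzRingType) (h : {rmorphism int -> S}).
Variable (sigma : I -> S).

Definition monomial_eval (m : cmonom I) : S := \prod_(v <- finsupp m) sigma v ^+ m v.

Lemma monomial_evalEw (m : cmonom I) (d : {fset I}) : finsupp m `<=` d ->
  monomial_eval m = \prod_(v <- d) sigma v ^+ m v.
Proof.
move=> sub; rewrite /monomial_eval; apply/big_fset_incl => // v _.
by rewrite -cmE_eq0 => /eqP ->; rewrite expr0.
Qed.

Lemma monomial_eval_mmorphism : mmorphism monomial_eval.
Proof.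
split=> [m1 m2|]; last by rewrite /monomial_eval mdom1 big_seq_fset0.
rewrite (monomial_evalEw (fsubsetUl (finsupp m1) (finsupp m2))).
rewrite (monomial_evalEw (fsubsetUr (finsupp m1) (finsupp m2))).
rewrite /monomial_eval mdomD -big_split /=.
by apply: eq_bigr => v _; rewrite cmM exprD.
Qed.

HB.instance Definition _ :=
  isMultiplicative.Build (cmonom I) S monomial_eval monomial_eval_mmorphism.

Definition eval : {malg int[cmonom I]} -> S := mmap h monomial_eval.

HB.instance Definition _ := GRing.RMorphism.on eval.

Lemma monomial_evalU v : monomial_eval (ucm v) = sigma v.
Proof. by rewrite /monomial_eval mdomU big_seq_fset1 cmUU expr1. Qed.

Lemma eval_var v : eval << ucm v >> = sigma v.
Proof. by rewrite /eval mmapU /= monomial_evalU (rmorph1 h) mul1r. Qed.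

End Substitution.

Lemma cmonom_factor (I : choiceType) (m : cmonom I) v : (0 < m v)%N ->
  exists m', m = (mmul (ucm v) m').
Proof.
move=> mv; exists (divcm m (ucm v)); apply/eqP/cmP => u.
rewrite cmM divcmE cmU; case: eqP => [<-|_]; last by rewrite subn0.
by rewrite subnKC.
Qed.

(** Induction on total degree: a nontrivial monomial has a variable in its support, and
    [cmonom_factor] splits it off. *)
Lemma malg_cmonom_ind (I : choiceType) (P : {malg int[cmonom I]} -> Prop) :
  (forall c, P c%:MP) -> (forall p q, P p -> P q -> P (p + q)) ->
  (forall v p, P p -> P (<< ucm v >> * p)) -> forall p, P p.
Proof.
move=> Pc PD PX p; have P0 : P 0 by rewrite -[0]malgC0E.
rewrite [p]monalgE; apply: (big_ind P) => // m _; move: (p@_m) => c.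
have [n] := ubnP (mdeg m); elim: n m => // n IH m; rewrite ltnS => dm.
case: (fset_0Vmem (finsupp m)) => [m0|[v]].
  have -> : m = mone.
    by apply/eqP/cmP => u; rewrite cm1; apply/eqP; rewrite cmE_eq0 m0.
  exact: Pc.
rewrite -cmE_neq0 -lt0n => mv; have [m' em] := cmonom_factor mv.
have -> : << c *g m >> = << ucm v >> * << c *g m' >> :> {malg int[cmonom I]}.
  by rewrite malgM_def fgmulUU mul1r -em.
apply: PX; apply: IH; move: dm; rewrite em mdegM mdegU; lia.
Qed.

Lemma rmorph_malg_ext (I : choiceType) (S : comNzRingType)
    (f g : {rmorphism {malg int[cmonom I]} -> S}) :
  (forall v, f << ucm v >> = g << ucm v >>) -> f =1 g.
Proof.
move=> fg; apply: malg_cmonom_ind => [c|p q fp fq|v p fp].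
- have -> : c%:MP = c%:~R :> {malg int[cmonom I]} by rewrite -[c in LHS]intz rmorph_int.
  by rewrite !rmorph_int.
- by rewrite !rmorphD fp fq.
- by rewrite !rmorphM fp fg.
Qed.

Lemma mmul_inj (I : choiceType) (m : cmonom I) : injective (mmul m).
Proof.
move=> m1 m2 e; apply/eqP/cmP => z.
by apply: (@addnI (m z)); rewrite -!cmM e.
Qed.

(** If $ur = vr$, then the coefficient of [r] at [m] equals the one at $um/v$, or is 0 when [v] does
    not divide [m]. Induction on the exponent of [v] gives $r = 0$. *)
Lemma var_diff_lreg (I : choiceType) (u v : I) (p q : {malg int[cmonom I]}) :
  u != v -> (<< ucm u >> - << ucm v >>) * p = (<< ucm u >> - << ucm v >>) * q -> p = q.
Proof.
move=> uv epq; apply/eqP; rewrite -subr_eq0.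
have huv : << ucm u >> * (p - q) = << ucm v >> * (p - q).
  by apply/eqP; rewrite -subr_eq0 -mulrBl mulrBr epq subrr.
move: (p - q) huv => r huv; apply/eqP/malgP => m.
have coefMU (w : I) (m' : cmonom I) : (<< ucm w >> * r)@_(mmul (ucm w) m') = r@_m'.
  rewrite malgM_def fgmulUg; rewrite raddf_sum /= [RHS](congr1 (fun x => x@_m') (monalgE r)).
  rewrite raddf_sum /=; apply: eq_bigr => k _; rewrite !mcoeffU mul1r.
  by rewrite (inj_eq (@mmul_inj _ _)).
have coefMU0 (w : I) (m' : cmonom I) : m' w = 0%N -> (<< ucm w >> * r)@_m' = 0.
  move=> m'0; rewrite malgM_def fgmulUg raddf_sum /=; apply: big1 => k _.
  rewrite mcoeffU; suff /negbTE -> : mmul (ucm w) k != m' by rewrite mulr0n.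
  by apply/eqP => e; move: m'0; rewrite -e cmM cmUU.
rewrite mcoeff0; move: {2}(m v).+1 (ltnSn (m v)) => n.
elim: n m => [m|n IH m dm]; first by rewrite ltn0.
rewrite -(coefMU u m) huv; case: (posnP (m v)) => [m0|mv].
  by apply: coefMU0; rewrite cmM m0 cmU (negbTE uv).
have [m' em] := cmonom_factor mv.
have -> : mmul (ucm u) m = mmul (ucm v) (mmul (ucm u) m').
  by rewrite em mulmA (mulmC (ucm u)) -mulmA.
rewrite coefMU; apply: IH; rewrite cmM cmU (negbTE uv).
by move: dm; rewrite em cmM cmUU; lia.
Qed.

(** * Trimming and grafting of forests *)

Fixpoint tree_eq (a b : tree) : bool :=
  match a, b with
  | Leaf, Leaf => true
  | Node l r, Node l' r' => tree_eq l l' && tree_eq r r'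
  | _, _ => false
  end.

Lemma tree_eqP : Equality.axiom tree_eq.
Proof.
elim=> [|l IHl r IHr] [|l' r'] /=; try by constructor.
by apply: (iffP andP) => [[/IHl -> /IHr ->]|[<- <-]] //; split; [apply/IHl|apply/IHr].
Qed.

HB.instance Definition _ := hasDecEq.Build tree tree_eqP.

Definition is_leaf (T : tree) : bool := if T is Leaf then true else false.
Definition nleavesF (F : forest) : nat := sumn (map nleaves F).

Lemma nleaves_gt0 T : (0 < nleaves T)%N.
Proof. by elim: T => //= l IHl r IHr; lia. Qed.

Lemma tqdesN off l r : tqdes off (Node l r) =
  if is_leaf l && is_leaf r then [:: off] else tqdes off l ++ tqdes (off + nleaves l) r.
Proof. by case: l; case: r. Qed.

Lemma tdelN off i l r : tdel off i (Node l r) =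
  if is_leaf l && is_leaf r then (if off == i then Leaf else Node l r)
  else Node (tdel off i l) (tdel (off + nleaves l) i r).
Proof. by case: l; case: r. Qed.

Lemma tqdes_bound off T i : i \in tqdes off T -> (off <= i)%N && (i.+1 < off + nleaves T)%N.
Proof.
elim: T off => // l IHl r IHr off; rewrite tqdesN.
have := nleaves_gt0 l; have := nleaves_gt0 r.
case: ifP => _; first by rewrite mem_seq1 => /= ? ? /eqP ->; lia.
by rewrite mem_cat => /= ? ? /orP[/IHl|/IHr]; lia.
Qed.

Lemma tqdes_Node off l r : exists i, i \in tqdes off (Node l r).
Proof.
suff h T : ~~ is_leaf T -> forall off, exists i, i \in tqdes off T by apply: h.
elim: T => // {}l IHl {}r IHr _ {}off; rewrite tqdesN.
case: ifP => [_|]; first by exists off; rewrite mem_seq1.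
case el : (is_leaf l) => /= er.
  by have [i hi] := IHr (negbT er) (off + nleaves l)%N; exists i; rewrite mem_cat hi orbT.
by have [i hi] := IHl (negbT el) off; exists i; rewrite mem_cat hi.
Qed.

Lemma tdel_id off T i : i \notin tqdes off T -> tdel off i T = T.
Proof.
elim: T off => // l IHl r IHr off; rewrite tqdesN tdelN.
case: ifP => _; first by rewrite mem_seq1 eq_sym => /negbTE ->.
by rewrite mem_cat negb_or => /andP[/IHl -> /IHr ->].
Qed.

Lemma nleaves_tdel off T i : i \in tqdes off T -> (nleaves (tdel off i T)).+1 = nleaves T.
Proof.
elim: T off => // l IHl r IHr off; rewrite tqdesN tdelN.
case: ifP => [/andP[]|_].
  by case: l {IHl} => // _; case: r {IHr} => // _; rewrite mem_seq1 eq_sym => ->.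
rewrite mem_cat; case: (boolP (i \in tqdes off l)) => /= [il _|il ir].
  rewrite (@tdel_id _ r); first by have := IHl _ il; lia.
  by apply/negP => /tqdes_bound; have := tqdes_bound il; lia.
by rewrite (@tdel_id _ l) //; have := IHr _ ir; lia.
Qed.

Lemma fqdes_bound off F i : i \in fqdes off F -> (off <= i)%N.
Proof.
elim: F off => // T F IH off /=; rewrite mem_cat => /orP[/tqdes_bound|/IH]; lia.
Qed.

Lemma fdel_id off F i : i \notin fqdes off F -> fdel off i F = F.
Proof.
elim: F off => //= T F IH off; rewrite mem_cat negb_or => /andP[/tdel_id -> /IH -> //].
Qed.

Lemma fqdes_cat off F G : fqdes off (F ++ G) = fqdes off F ++ fqdes (off + nleavesF F) G.
Proof.
elim: F off => [|T F IH] off; first by rewrite /nleavesF /= addn0.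
by rewrite /= IH catA addnA.
Qed.

Lemma fqdes_leaves off n : fqdes off (nseq n Leaf) = [::].
Proof. by elim: n off => //= n IH off; apply: IH. Qed.

Lemma fdel_cat_leaves off i F n : fdel off i (F ++ nseq n Leaf) = fdel off i F ++ nseq n Leaf.
Proof.
elim: F off => [|T F IH] off /=; last by rewrite IH.
by elim: n off => //= n IH off; rewrite IH.
Qed.

Lemma strip_decomp F : exists n, F = strip F ++ nseq n Leaf.
Proof.
rewrite /strip; rewrite -{1}[F]revK; elim: (rev F) => [|[|l r] G [n e]] /=.
- by exists 0%N.
- exists n.+1; rewrite rev_cons {1}e rcons_cat; congr (_ ++ _).
  by elim: n {e} => //= n ->.
- by exists 0%N; rewrite cats0.
Qed.

Lemma strip_cat_leaves F n : strip (F ++ nseq n Leaf) = strip F.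
Proof.
by rewrite /strip rev_cat rev_nseq; congr rev; elim: n.
Qed.

Lemma strip_idem F : strip (strip F) = strip F.
Proof. by have [n e] := strip_decomp F; rewrite -(strip_cat_leaves _ n) -e. Qed.

Lemma canon_decomp F : canon F -> F = [::] \/ exists G l r, F = rcons G (Node l r).
Proof.
rewrite /canon /strip => e; case h : (drop_leaves (rev F)) => [|T G].
  by left; rewrite -e h.
right; have : ~~ is_leaf T.
  by elim: (rev F) h => [|[|l r] H IH] //= [<-].
case: T h => // l r h _; exists (rev G), l, r.
by rewrite -e h rev_cons.
Qed.

Lemma Qdes_strip F : Qdes (strip F) = Qdes F.
Proof.
have [n e] := strip_decomp F; rewrite {2}e /Qdes fqdes_cat fqdes_leaves cats0 //.
Qed.

Lemma fquot_canon F i : canon (fquot F i).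
Proof. exact: strip_idem. Qed.

Lemma fquot_strip F i : fquot (strip F) i = fquot F i.
Proof.
have [n e] := strip_decomp F.
by rewrite /fquot {2}e fdel_cat_leaves strip_cat_leaves.
Qed.

Lemma Qdes_nonempty F : canon F -> F <> [::] -> exists i, i \in Qdes F.
Proof.
case/canon_decomp => // -[G [l [r ->]]] _; rewrite /Qdes -cats1 fqdes_cat /= cats0.
have [i hi] := tqdes_Node (0 + nleavesF G) l r; exists i.
by rewrite mem_cat hi orbT.
Qed.

(** Grafting, the inverse of [tdel]: leaf [i] becomes a terminal node and all later leaves move up
    by one. *)
Fixpoint tins (off i : nat) (T : tree) : tree :=
  match T with
  | Leaf => if off == i then Node Leaf Leaf else Leaf
  | Node l r => if (i < off + nleaves l)%N then Node (tins off i l) r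
                else Node l (tins (off + nleaves l) i r)
  end.

(** An exhausted list stands for infinitely many one-node trees, so it is padded with leaves until
    the new tree sits at leaf [i]. *)
Fixpoint fins (off i : nat) (F : forest) : forest :=
  match F with
  | [::] => rcons (nseq (i - off) Leaf) (Node Leaf Leaf)
  | T :: F' => if (i < off + nleaves T)%N then tins off i T :: F'
               else T :: fins (off + nleaves T) i F'
  end.

Lemma tins_tdel off i T : i \in tqdes off T -> tins off i (tdel off i T) = T.
Proof.
elim: T off => // l IHl r IHr off; rewrite tqdesN tdelN.
case: ifP => [/andP[]|_].
  by case: l {IHl} => // _; case: r {IHr} => // _; rewrite mem_seq1 eq_sym => h; rewrite h /= h.
rewrite mem_cat /=; case: (boolP (i \in tqdes off l)) => /= [il _|il ir].
  have := tqdes_bound il; have := nleaves_tdel il => e b.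
  rewrite ifT; last by lia.
  by rewrite IHl // tdel_id //; apply/negP => /tqdes_bound; lia.
have := tqdes_bound ir => b.
by rewrite (@tdel_id _ l) // ifF ?IHr //; lia.
Qed.

Lemma fins_fdel off i F : i \in fqdes off F -> fins off i (fdel off i F) = F.
Proof.
elim: F off => // T F IH off /=; rewrite mem_cat.
case: (boolP (i \in tqdes off T)) => /= [iT _|iT iF].
  have := tqdes_bound iT; have := nleaves_tdel iT => e b.
  rewrite ifT; last by lia.
  by rewrite tins_tdel // fdel_id //; apply/negP => /fqdes_bound; lia.
have := fqdes_bound iF => b.
by rewrite tdel_id // ifF ?IH //; lia.
Qed.

Lemma fins_cat_leaves off i F n : (off <= i)%N ->
  exists m, fins off i (F ++ nseq n Leaf) = fins off i F ++ nseq m Leaf.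
Proof.
elim: F off => [|T F IH] off /= oi; last first.
  case: ltnP => iT; first by exists n.
  by have [m ->] := IH _ iT; exists m.
elim: n off oi => [|n IH] off /= oi; first by exists 0%N; rewrite cats0.
case: ltnP => h.
  have -> : off = i by lia.
  by exists n; rewrite eqxx subnn.
have [m ->] := IH _ h; exists m.
by have -> : (i - off = (i - (off + 1)).+1)%N by lia.
Qed.

Lemma fins_fquot F i : canon F -> i \in Qdes F -> strip (fins 0 i (fquot F i)) = F.
Proof.
move=> cF iF; have [n e] := strip_decomp (fdel 0 i F).
have [m e'] := @fins_cat_leaves 0 i (fquot F i) n (leq0n i).
by rewrite -(strip_cat_leaves _ m) -e' -e fins_fdel.
Qed.

(** Grafting at [i] recovers the forest. This is what produces the Kronecker delta in
    [forest_dual]. *)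
Lemma fquot_inj F G i : canon F -> canon G -> i \in Qdes F -> i \in Qdes G ->
  fquot F i = fquot G i -> F = G.
Proof. by move=> cF cG iF iG e; rewrite -(fins_fquot cF iF) e fins_fquot. Qed.

Lemma tins_mem off i T : (off <= i)%N -> (i < off + nleaves T)%N ->
  i \in tqdes off (tins off i T) /\ tdel off i (tins off i T) = T.
Proof.
elim: T off => [|l IHl r IHr] off /= oi iT.
  have -> : off = i by lia.
  by rewrite eqxx /= mem_seq1 eqxx.
case: ltnP => il.
  have [h1 h2] := IHl _ oi il.
  have nl : is_leaf (tins off i l) = false by case: (tins off i l) h1.
  rewrite tqdesN tdelN nl /= mem_cat h1 h2; split => //; congr Node; apply: tdel_id.
  have := nleaves_tdel h1; rewrite h2 => e.
  by apply/negP => /tqdes_bound; lia.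
have [h1 h2] := IHr _ il (ltac:(lia)).
have nr : is_leaf (tins (off + nleaves l) i r) = false by case: (tins _ i r) h1.
rewrite tqdesN tdelN nr andbF /= mem_cat h1 h2 orbT; split => //; congr Node.
by apply: tdel_id; apply/negP => /tqdes_bound; lia.
Qed.

Lemma fins_mem off i F : (off <= i)%N ->
  i \in fqdes off (fins off i F) /\ strip (fdel off i (fins off i F)) = strip F.
Proof.
move=> oi; suff [h1 [n h2]] : i \in fqdes off (fins off i F) /\
    exists n, fdel off i (fins off i F) = F ++ nseq n Leaf.
  by rewrite h2 strip_cat_leaves.
elim: F off oi => [|T F IH] off oi /=.
  have e : (off + (i - off) = i)%N by lia.
  rewrite -cats1 fqdes_cat /= fqdes_leaves /= mem_seq1.
  have -> : (nleavesF (nseq (i - off) Leaf) = i - off)%N.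
    by rewrite /nleavesF map_nseq sumn_nseq mul1n.
  rewrite e eqxx; split=> //; exists (i - off).+1.
  move: (i - off)%N e => n; elim: n off {oi} => [|n IHn] off e /=.
    by rewrite -e addn0 eqxx.
  by rewrite IHn //; lia.
case: ltnP => iT /=.
  have [h1 h2] := tins_mem oi iT; rewrite mem_cat h1; split=> //; exists 0%N.
  rewrite cats0 h2; congr cons; apply: fdel_id.
  by have := nleaves_tdel h1; rewrite h2 => e; apply/negP => /fqdes_bound; lia.
have [h1 [n h2]] := IH _ iT; rewrite mem_cat h1 orbT; split=> //; exists n.
by rewrite h2 tdel_id //; apply/negP => /tqdes_bound; lia.
Qed.

(** The witness is the graft of a terminal node at leaf [i]. It lets [separation] pass from $f$ to
    $E_i f$. *)
Lemma exists_fquot F i : canon F -> exists G, [/\ canon G, i \in Qdes G & fquot G i = F].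
Proof.
move=> cF; have [h1 h2] := @fins_mem 0 i F (leq0n i).
exists (strip (fins 0 i F)); split; first exact: strip_idem.
  by rewrite Qdes_strip.
by rewrite fquot_strip /fquot h2.
Qed.

(** * Finiteness of the set of forests of bounded size *)

Definition nnodes (F : forest) : nat := sumn [seq (nleaves T).-1 | T <- F].

Lemma nnodes_strip F : nnodes (strip F) = nnodes F.
Proof.
have [n e] := strip_decomp F; rewrite {2}e /nnodes map_cat sumn_cat map_nseq sumn_nseq.
by rewrite mul0n addn0.
Qed.

Lemma nnodes_fquot F i : i \in Qdes F -> (nnodes (fquot F i)).+1 = nnodes F.
Proof.
rewrite nnodes_strip /Qdes; elim: F 0%N => // T F IH off /=; rewrite mem_cat.
case: (boolP (i \in tqdes off T)) => /= [iT _|iT iF].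
  rewrite fdel_id; last first.
    by apply/negP => /fqdes_bound; have := tqdes_bound iT; lia.
  have := nleaves_tdel iT; have := nleaves_gt0 (tdel off i T); rewrite /nnodes /=; lia.
by rewrite tdel_id // /nnodes /=; have := IH _ iF; rewrite /nnodes; lia.
Qed.

(** The trees of height at most [n]; a tree with at most [n.+1] leaves is never higher than that. *)
Fixpoint trees n : seq tree :=
  if n is n'.+1 then Leaf :: [seq Node l r | l <- trees n', r <- trees n'] else [:: Leaf].

Lemma mem_trees n T : (nleaves T <= n.+1)%N -> T \in trees n.
Proof.
elim: n T => [|n IH] [|l r] //=; have := nleaves_gt0 l; have := nleaves_gt0 r; first by lia.
move=> r0 l0 lr; rewrite inE; apply/orP; right; apply: allpairs_f; apply: IH; lia.
Qed.

Fixpoint forests n N : seq forest :=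
  if N is N'.+1 then [::] :: [seq T :: F | T <- trees n, F <- forests n N'] else [:: [::]].

Lemma mem_forests n N F : (size F <= N)%N -> (nnodes F <= n)%N -> F \in forests n N.
Proof.
elim: N F => [|N IH] [|T F] //= sF nF; rewrite inE; apply/orP; right.
move: nF; rewrite /nnodes /= => nF.
by apply: allpairs_f; [apply: mem_trees; lia|apply: IH => //; rewrite /nnodes; lia].
Qed.

(** * Divided differences *)

Definition swap (a b i : nat) : nat := if i == a then b else if i == b then a else i.
(** The increasing enumeration of the naturals other than [i]; it matches the slots left after
    $R_i^-$ has filled slot [i] with the old ones. *)
Definition up (i k : nat) : nat := if (k < i)%N then k else k.+1.

Ltac index_cases :=
  rewrite ?/swap ?/up /=;
  repeat (match goal with |- context [if ?b then _ else _] =>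
    lazymatch b with context [if _ then _ else _] => fail | _ => case: (boolP b) => ? end
  end);
  first [done | exfalso; lia | congr (_ _); lia | lia | idtac].

(* The polynomial ring in the x_i and t_i is kept abstract: on the concrete monoid
   algebra, unification tends to unfold monomials and diverge. *)
Section Operators.
Variables (R : comNzRingType) (x t : nat -> R).
Variable sub : (nat -> R) -> (nat -> R) -> {rmorphism R -> R}.
Hypothesis sub_x : forall s r i, sub s r (x i) = s i.
Hypothesis sub_t : forall s r i, sub s r (t i) = r i.
Hypothesis rmorph_ext : forall f g : {rmorphism R -> R},
  (forall i, f (x i) = g (x i)) -> (forall i, f (t i) = g (t i)) -> f =1 g.
Hypothesis poly_ind : forall P : R -> Prop,
  (forall c : int, P c%:~R) -> (forall p q, P p -> P q -> P (p + q)) ->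
  (forall i p, P p -> P (x i * p)) -> (forall i p, P p -> P (t i * p)) ->
  forall p, P p.
Hypothesis x_diff_lreg : forall i j p q, i != j ->
  (x i - x j) * p = (x i - x j) * q -> p = q.
Hypothesis xt_diff_lreg : forall i j p q,
  (x i - t j) * p = (x i - t j) * q -> p = q.

Definition sx (s : nat -> R) : {rmorphism R -> R} := sub s t.

Lemma sx_x s i : sx s (x i) = s i. Proof. exact: sub_x. Qed.
Lemma sx_t s i : sx s (t i) = t i. Proof. exact: sub_t. Qed.

Lemma sub_ext s s' r r' : s =1 s' -> r =1 r' -> sub s r =1 sub s' r'.
Proof. by move=> ss rr; apply: rmorph_ext => i; rewrite ?sub_x ?sub_t. Qed.

Lemma sx_ext s s' : s =1 s' -> sx s =1 sx s'.
Proof. by move=> ss; apply: sub_ext. Qed.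

Lemma sub_comp s r s' r' p :
  sub s r (sub s' r' p) = sub (fun i => sub s r (s' i)) (fun i => sub s r (r' i)) p.
Proof.
apply: (rmorph_ext (f := sub s r \o sub s' r')) => i /=.
  by rewrite !sub_x.
by rewrite !sub_t.
Qed.

Lemma sx_comp s s' p : sx s (sx s' p) = sx (fun i => sx s (s' i)) p.
Proof. by rewrite /sx sub_comp; apply: sub_ext => // i; rewrite sub_t. Qed.

Lemma sx_id s : s =1 x -> sx s =1 id.
Proof.
move=> sE; apply: (rmorph_ext (g := idfun)) => i /=; by rewrite ?sx_x ?sx_t.
Qed.

Definition sw a b : {rmorphism R -> R} := sx (fun i => x (swap a b i)).

Lemma sw_x a b i : sw a b (x i) = x (swap a b i). Proof. exact: sx_x. Qed.

Lemma sw_invol a b p : sw a b (sw a b p) = p.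
Proof. by rewrite /sw sx_comp; apply: sx_id => i; rewrite sx_x; index_cases. Qed.

(** Divisibility by induction on [f]. The equation is boolean so that [xchoose] can extract the
    quotient. *)
Lemma dd_exists a b f : exists g, (x a - x b) * g == f - sw a b f.
Proof.
elim/poly_ind: f => [c|p q [g /eqP gp] [h /eqP hq]|i p [g /eqP gp]|i p [g /eqP gp]].
- by exists 0; rewrite rmorph_int subrr mulr0.
- by exists (g + h); rewrite rmorphD mulrDr gp hq; apply/eqP; ring.
(* Twisted Leibniz rule, with $s$ the transposition: $x_i p - x_{s(i)} s(p) = (x_i - x_{s(i)}) p +
   x_{s(i)} (p - s(p))$. *)
- exists (((i == a)%:R - (i == b)%:R) * p + x (swap a b i) * g).
  rewrite rmorphM sw_x mulrDr [_ * (_ * g)]mulrCA gp mulrA.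
  suff -> : (x a - x b) * ((i == a)%:R - (i == b)%:R) = x i - x (swap a b i).
    by apply/eqP; ring.
  rewrite /swap; case: (eqVneq i a) => [->|ia]; case: (eqVneq _ b) => [ib|ib] //=; subst; ring.
- exists (t i * g).
  by rewrite rmorphM sx_t mulrCA gp mulrBr.
Qed.

Definition dd a b f : R := xchoose (dd_exists a b f).

Lemma ddE a b f : (x a - x b) * dd a b f = f - sw a b f.
Proof. exact/eqP/(xchooseP (dd_exists a b f)). Qed.

Lemma ddP a b f g : a != b -> (x a - x b) * g = f - sw a b f -> dd a b f = g.
Proof. by move=> ab e; apply: (x_diff_lreg ab); rewrite ddE. Qed.

Lemma sw_dd a b f : sw a b f = f + (x b - x a) * dd a b f.
Proof. by rewrite -[x b - x a]opprB mulNr ddE; ring. Qed.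

Lemma ddD a b f g : a != b -> dd a b (f + g) = dd a b f + dd a b g.
Proof. by move=> ab; apply: ddP => //; rewrite rmorphD mulrDr !ddE; ring. Qed.

Lemma dd0 a b : a != b -> dd a b 0 = 0.
Proof. by move=> ab; apply: ddP => //; rewrite rmorph0 mulr0 subrr. Qed.

Lemma ddN a b f : a != b -> dd a b (- f) = - dd a b f.
Proof. by move=> ab; apply: ddP => //; rewrite rmorphN mulrN ddE; ring. Qed.

Lemma ddM a b f g : a != b -> dd a b (f * g) = dd a b f * g + sw a b f * dd a b g.
Proof.
move=> ab; apply: ddP => //.
by rewrite rmorphM mulrDr mulrA ddE mulrCA ddE; ring.
Qed.

Lemma dd_inv a b f : a != b -> sw a b f = f -> dd a b f = 0.
Proof. by move=> ab e; apply: ddP => //; rewrite e mulr0 subrr. Qed.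

Lemma ddM_inv a b f g : a != b -> sw a b f = f -> dd a b (f * g) = f * dd a b g.
Proof. by move=> ab e; rewrite ddM // dd_inv // e mul0r add0r. Qed.

Lemma dd_x a b i : a != b -> dd a b (x i) = (i == a)%:R - (i == b)%:R.
Proof.
move=> ab; apply: ddP => //; rewrite sw_x /swap.
by case: (eqVneq i a) => [->|ia]; case: (eqVneq _ b) => [ib|ib] //=; subst; ring.
Qed.

Lemma dd_sym a b f : a != b -> sw a b (dd a b f) = dd a b f.
Proof.
move=> ab; apply: (x_diff_lreg ab); rewrite ddE.
have := congr1 (sw a b) (ddE a b f); rewrite rmorphM !rmorphB /= !sw_x sw_invol.
have -> : swap a b a = b by index_cases.
have -> : swap a b b = a by index_cases.
by move=> e; rewrite -[RHS]opprB -e; ring.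
Qed.

Lemma dd_dd a b f : a != b -> dd a b (dd a b f) = 0.
Proof. by move=> ab; apply: dd_inv => //; apply: dd_sym. Qed.

(** A substitution that intertwines the two transpositions carries the equation defining one divided
    difference to the equation defining the other. *)
Lemma dd_natural s r a b c d : c != d -> s a = x c -> s b = x d ->
  (forall i, sw c d (s i) = s (swap a b i)) -> (forall i, sw c d (r i) = r i) ->
  forall f, sub s r (dd a b f) = dd c d (sub s r f).
Proof.
move=> cd sa sb ss sr f; apply/esym/ddP => //.
have -> : sw c d (sub s r f) = sub s r (sw a b f).
  by rewrite /sw /sx !sub_comp; apply: sub_ext => i; rewrite ?sub_x ?sub_t ?ss ?sr.
by rewrite -rmorphB -ddE rmorphM rmorphB /= !sub_x sa sb.
Qed.

Lemma sw_dd_comm a b c d f : a != b -> c != d ->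
  a != c -> a != d -> b != c -> b != d -> sw a b (dd c d f) = dd c d (sw a b f).
Proof.
move=> ab cd ac ad bc bd; apply: dd_natural => // [||i|i]; rewrite ?sw_x ?sx_t //.
all: by index_cases.
Qed.

Lemma dd_comm a b c d f : a != b -> c != d ->
  a != c -> a != d -> b != c -> b != d -> dd a b (dd c d f) = dd c d (dd a b f).
Proof.
move=> ab cd ac ad bc bd; apply: ddP => //.
rewrite -ddM_inv //; last by rewrite rmorphB /= !sw_x; index_cases.
rewrite ddE sw_dd_comm //; apply/eqP; rewrite -subr_eq0; apply/eqP.
by rewrite ddD // ddN //; ring.
Qed.

Lemma sw_braid a b c f : a != b -> b != c -> a != c ->
  sw a b (sw b c (sw a b f)) = sw a c f.
Proof.
move=> ab bc ac; rewrite /sw !sx_comp; apply: sx_ext => i.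
by rewrite !sx_x; index_cases.
Qed.

Section ThreeVariables.
Variables (a b c : nat).
Hypotheses (ab : a != b) (bc : b != c) (ac : a != c).

(** Expand $s_{ac} = s_{ab} s_{bc} s_{ab}$ using [sw_dd] for each factor. *)
Lemma dd_transposition f : dd a c f = dd a b f + dd b c f
  + (x b - x a) * dd a b (dd b c f) + (x c - x b) * dd b c (dd a b f)
  + (x b - x a) * (x c - x b) * dd a b (dd b c (dd a b f)).
Proof.
apply: ddP => //; rewrite -(@sw_braid a b c) //.
rewrite [sw a b f]sw_dd rmorphD rmorphM rmorphB /= !sw_x.
rewrite [sw b c f]sw_dd [sw b c (dd a b f)]sw_dd.
have -> : swap b c b = c by index_cases.
have -> : swap b c a = a by index_cases.
rewrite !(rmorphB, rmorphD, rmorphM, rmorphN) /= !sw_x dd_sym //.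
have -> : swap a b c = c by index_cases.
have -> : swap a b b = a by index_cases.
have -> : swap a b a = b by index_cases.
rewrite !sw_dd; ring.
Qed.

(** The right side is the alternating sum over the permutations of [a], [b], [c]; its symmetry in
    [a] and [c] gives the braid relation. *)
Lemma dd_braid_aux f : (x a - x b) * (x b - x c) * (x a - x c) * dd a b (dd b c (dd a b f))
  = f - sw a b f - sw b c f + sw b c (sw a b f) + sw a b (sw b c f) - sw a c f.
Proof.
have e1 : (x a - x c) * sw a b (dd b c (dd a b f)) = dd a b f - sw a b (sw b c (dd a b f)).
  have := congr1 (sw a b) (ddE b c (dd a b f)).
  rewrite rmorphM !rmorphB /= !sw_x dd_sym // => <-.
  by congr (_ * _); index_cases.
transitivity ((x b - x c) * (x a - x c) * ((x a - x b) * dd a b (dd b c (dd a b f)))).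
  by ring.
rewrite ddE mulrBr -[in X in _ - X]mulrA e1 mulrAC ddE.
have e2 : (x a - x c) * sw b c (dd a b f) = sw b c f - sw b c (sw a b f).
  have := congr1 (sw b c) (ddE a b f); rewrite rmorphM !rmorphB /= !sw_x => <-.
  by congr (_ * _); index_cases.
have e3 : (x b - x c) * sw a b (sw b c (dd a b f)) = sw a b (sw b c f) - sw a c f.
  rewrite -(@sw_braid a b c f) // -rmorphB -e2 rmorphM rmorphB /= !sw_x.
  by congr (_ * _); index_cases.
transitivity ((x a - x b) * dd a b f - (x a - x c) * sw b c (dd a b f)
  + (x b - x c) * sw a b (sw b c (dd a b f))); first by ring.
by rewrite ddE e2 e3; ring.
Qed.

End ThreeVariables.

Lemma dd_flip a b f : a != b -> dd b a f = - dd a b f.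
Proof.
move=> ab; apply: ddP; first by rewrite eq_sym.
have -> : sw b a f = sw a b f by apply: sx_ext => i; index_cases.
by rewrite -ddE; ring.
Qed.

Lemma dd_braid a b c f : a != b -> b != c -> a != c ->
  dd a b (dd b c (dd a b f)) = dd b c (dd a b (dd b c f)).
Proof.
move=> ab bc ac; apply: (x_diff_lreg ac); apply: (x_diff_lreg bc); apply: (x_diff_lreg ab).
rewrite !mulrA dd_braid_aux //.
have cb : c != b by rewrite eq_sym.
have ba : b != a by rewrite eq_sym.
have ca : c != a by rewrite eq_sym.
(* Exchanging [a] and [c] preserves the alternating sum, while the Vandermonde product and the three
   flipped differences each contribute one sign. *)
have := dd_braid_aux cb ba ca f.
have swC u v h : sw u v h = sw v u h by apply: sx_ext => i; index_cases.
rewrite (swC c b) !(swC c b) (swC b a) !(swC b a) (swC c a).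
rewrite (dd_flip _ bc) (dd_flip _ bc) (dd_flip _ ab) !ddN //.
move=> e.
transitivity (f - sw b c f - sw a b f + sw a b (sw b c f) + sw b c (sw a b f) - sw a c f);
  first by ring.
by rewrite -e; ring.
Qed.

(** $R_i^-$ with $t_j$ inserted instead of $t_i$: repeated trimming shifts the parameters, so the
    slot and the parameter become independent. *)
Definition Rm i j : {rmorphism R -> R} :=
  sx (fun k => if (k < i)%N then x k else if k == i then t j else x k.-1).

Lemma Rm_dd i j a b f : a != b -> Rm i j (dd (up i a) (up i b) f) = dd a b (Rm i j f).
Proof.
move=> ab; apply: dd_natural => // [||k|k]; last by rewrite sx_t.
1,2: by index_cases.
transitivity (if (k < i)%N then x (swap a b k)
              else if k == i then t j else x (swap a b k.-1)).
  by case: ifP => _; [|case: ifP => _]; rewrite ?sw_x ?sx_t.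
by index_cases.
Qed.

Definition ev (tau : nat -> nat) : {rmorphism R -> R} := sx (fun k => t (tau k)).

(** Evaluation in two stages: slot [i] first, then the remaining slots, renumbered by [up i]. *)
Lemma ev_Rm tau i p : ev tau p = ev (fun k => tau (up i k)) (Rm i (tau i) p).
Proof.
rewrite /ev /Rm sx_comp; apply: sx_ext => k.
case: ifP => [ki|ki]; last case: eqP => [->|ki']; rewrite ?sx_x ?sx_t //.
  by rewrite /up ki.
by congr (t (tau _)); rewrite /up; case: ifP => ?; lia.
Qed.

(** * Words in simple divided differences and their normal forms *)

Definition d i := dd i i.+1.
Definition wd (w : seq nat) f := foldr d f w.

Lemma neqS i : i != i.+1. Proof. by lia. Qed.
Local Hint Resolve neqS : core.

Lemma wd_cat w1 w2 f : wd (w1 ++ w2) f = wd w1 (wd w2 f).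
Proof. exact: foldr_cat. Qed.

Lemma wd0 w : wd w 0 = 0.
Proof. by elim: w => //= l w ->; rewrite /d dd0. Qed.

Lemma d_d i f : d i (d i f) = 0. Proof. exact: dd_dd. Qed.

Lemma d_braid i f : d i (d i.+1 (d i f)) = d i.+1 (d i (d i.+1 f)).
Proof. by apply: dd_braid; lia. Qed.

Lemma d_comm i j f : ((i.+1 < j) || (j.+1 < i))%N -> d i (d j f) = d j (d i f).
Proof. by move=> ij; apply: dd_comm; lia. Qed.

Lemma d_wd_comm j w f : all (fun l => (l.+1 < j) || (j.+1 < l))%N w ->
  d j (wd w f) = wd w (d j f).
Proof.
elim: w => //= l w IH /andP[lj lw]; rewrite d_comm ?IH //.
by case/orP: lj => ->; rewrite ?orbT.
Qed.

(** The descending word $M-1, \dots, k$, empty when $M \le k$. *)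
Definition Cw k M := rev (iota k (M - k)).

Lemma Cwkk k : Cw k k = [::]. Proof. by rewrite /Cw subnn. Qed.

Lemma Cw_cat k m M : (k <= m)%N -> (m <= M)%N -> Cw k M = Cw m M ++ Cw k m.
Proof.
move=> km mM; rewrite /Cw -rev_cat; congr rev.
by rewrite -{2}(subnKC km) -iotaD; congr iota; lia.
Qed.

Lemma CwS k M : (k <= M)%N -> Cw k M.+1 = M :: Cw k M.
Proof.
by move=> kM; rewrite (Cw_cat kM (leqnSn M)) {1}/Cw subSnn.
Qed.

Lemma mem_Cw k M l : (l \in Cw k M) = (k <= l < M)%N.
Proof.
rewrite mem_rev mem_iota; case: (leqP k M) => kM; first by rewrite subnKC.
by move/ltnW: (kM); rewrite -subn_eq0 => /eqP ->; lia.
Qed.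

(** Letters above $j+1$ commute with [d j], a braid move at $j+1, j$ turns it into [d j.+1], and
    that commutes with the letters below. *)
Lemma d_Cw k M j f : (k <= j)%N -> (j.+1 < M)%N ->
  d j (wd (Cw k M) f) = wd (Cw k M) (d j.+1 f).
Proof.
move=> kj; elim: M => // M IH; rewrite ltnS leq_eqVlt => /orP[/eqP <-|jM].
  rewrite CwS ?CwS //=; last by lia.
  rewrite d_braid (@d_wd_comm j.+1) //.
  by apply/allP => l; rewrite mem_Cw; lia.
by rewrite CwS /=; [rewrite d_comm ?IH // | ]; lia.
Qed.

(** Absorbing [M] on the left gives the words [Cw k M.+1], [Cw k.+1 M.+1]; absorbing [k] on the
    right gives [Cw k M], [Cw k M.+1]. The claim [shift] identifies the two products. *)
Lemma d_CwCw k M f : (k <= M)%N ->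
  d M (wd (Cw k M) (wd (Cw k.+1 M.+1) f)) = wd (Cw k M) (wd (Cw k.+1 M.+1) (d k f)).
Proof.
move=> kM.
(* Each letter of [Cw k m] rises by one as [d_Cw] carries it through the longer word. *)
have shift m g : (k <= m)%N -> (m <= M)%N ->
    wd (Cw k m) (wd (Cw k M.+1) g) = wd (Cw k M.+1) (wd (Cw k.+1 m.+1) g).
  elim: m g => [|m IH] g km mM.
    by move: km; rewrite leqn0 => /eqP ->; rewrite !Cwkk.
  move: km; rewrite leq_eqVlt => /orP[/eqP <-|km]; first by rewrite !Cwkk.
  have mM1 : (m.+1 < M.+1)%N by [].
  by rewrite (@CwS k m) // (@CwS k.+1 m.+1) //= IH ?(ltnW mM) // d_Cw.
have -> : wd (Cw k.+1 M.+1) (d k f) = wd (Cw k M.+1) f.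
  by rewrite (@Cw_cat k k.+1 M.+1) // wd_cat (@CwS k k) // Cwkk.
by rewrite shift // (CwS kM).
Qed.

(* Normal forms for products of divided differences: a Grassmannian part, whose
   image sequence M is strictly increasing, times a word avoiding letter i-1. *)
Inductive normal_form i : nat -> nat -> seq nat -> Prop :=
| normal_form_base L w : all (fun l => l.+1 != i) w -> normal_form i i L w
| normal_form_step k L M w : (k < i)%N -> (k <= M)%N -> (L <= M)%N -> normal_form i k.+1 M.+1 w ->
    normal_form i k L (Cw k M ++ w).

Lemma normal_form_inv i k L w : normal_form i k L w ->
  (k = i /\ all (fun l => l.+1 != i) w) \/
  exists M w', [/\ (k < i)%N, (k <= M)%N, (L <= M)%N, normal_form i k.+1 M.+1 w' & w = Cw k M ++ w'].
Proof. by case=> [*|k' L' M w' *]; [left|right; exists M, w']. Qed.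

Lemma normal_form_nil i k : (k <= i)%N -> normal_form i k k [::].
Proof.
move=> ki; rewrite -(subKn ki); elim: (i - k)%N (leq_subr k i) => [|m IH] mi.
  by rewrite subn0; apply: normal_form_base.
have e : (i - m.+1).+1 = (i - m)%N by lia.
have -> : [::] = Cw (i - m.+1) (i - m.+1) ++ [::] by rewrite Cwkk.
by apply: normal_form_step; [lia|lia|lia|rewrite e; apply: IH; lia].
Qed.

(** All block letters are at least [k], so [j] commutes into the tail; $j+1 < k \le i$ keeps it
    different from $i-1$. *)
Lemma normal_form_comm i k L w j : normal_form i k L w -> (j.+1 < k)%N ->
  exists2 w', normal_form i k L w' & forall f, d j (wd w f) = wd w' f.
Proof.
elim=> [{}L {}w aw|{}k {}L M {}w ki kM LM h IH] jk.
  exists (j :: w) => //; apply: normal_form_base => /=; rewrite aw andbT; lia.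
have [|w' h' e] := IH; first by lia.
exists (Cw k M ++ w'); first exact: normal_form_step.
move=> f; rewrite !wd_cat d_wd_comm ?e //.
by apply/allP => l; rewrite mem_Cw; lia.
Qed.

(** The new letter passes a block (unchanged or raised by one), is annihilated by its top letter,
    extends it, or ends in the tail. *)
Lemma normal_form_left i k L w j : normal_form i k L w -> (k <= j)%N ->
  (forall f, d j (wd w f) = 0) \/
  exists2 w', normal_form i k L w' & forall f, d j (wd w f) = wd w' f.
Proof.
move=> h; elim: h j => [{}L {}w aw|{}k {}L M {}w ki kM LM h IH] j kj.
  right; exists (j :: w) => //; apply: normal_form_base => /=; rewrite aw andbT; lia.
have [jM|jM|jM] := ltngtP j M.
- have [jM1|jM1] := ltnP j.+1 M.
    have [|e0|[w' h' e]] := IH j.+1; first by lia.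
      by left=> f; rewrite !wd_cat d_Cw // e0 wd0.
    right; exists (Cw k M ++ w'); first exact: normal_form_step.
    by move=> f; rewrite !wd_cat d_Cw // e.
  left=> f; have -> : M = j.+1 by lia.
  by rewrite wd_cat CwS //= d_d.
- have c : all (fun l => (l.+1 < j) || (j.+1 < l))%N (Cw k M).
    by apply/allP => l; rewrite mem_Cw; lia.
  have [|e0|[w' h' e]] := IH j; first by lia.
    by left=> f; rewrite !wd_cat d_wd_comm // e0 wd0.
  right; exists (Cw k M ++ w'); first exact: normal_form_step.
  by move=> f; rewrite !wd_cat d_wd_comm // e.
(* For $j = M$ the block grows to [Cw k M.+1]. Only a next block with the same upper bound obstructs
   this; then [d_CwCw] releases the letter [k] on the right, which commutes into the tail. *)
rewrite {j kj}jM; right; case: (normal_form_inv h) => [[ki' aw]|[M1 [w2 [ki' kM1 MM1 h2 ew]]]].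
  exists (Cw k M.+1 ++ w); last by move=> f; rewrite !wd_cat CwS.
  apply: normal_form_step => //; [by lia|by lia|].
  by rewrite ki'; apply: normal_form_base.
have [MM1'|] := ltnP M.+1 M1.
  exists (Cw k M.+1 ++ w); last by move=> f; rewrite !wd_cat CwS.
  apply: normal_form_step => //; [by lia|by lia|].
  by rewrite ew; apply: normal_form_step.
move=> M1M; have eM : M1 = M.+1 by lia.
rewrite {M1}eM in kM1 MM1 h2 ew M1M *.
have [|w2' h2' e2] := normal_form_comm (j := k) h2; first by lia.
exists (Cw k M ++ Cw k.+1 M.+1 ++ w2').
  by apply: normal_form_step => //; apply: normal_form_step.
by move=> f; rewrite ew !wd_cat d_CwCw // e2.
Qed.

Lemma normal_form_exists i w : (forall f, wd w f = 0) \/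
  exists2 w', normal_form i 0 0 w' & forall f, wd w f = wd w' f.
Proof.
elim: w => [|j w [e0|[w' h e]]]; first by right; exists [::] => //; apply: normal_form_nil.
  by left=> f; rewrite /= e0 /d dd0.
have [e0|[w2 h2 e2]] := normal_form_left h (leq0n j); first by left=> f; rewrite /= e.
by right; exists w2 => // f; rewrite /= e.
Qed.

(** * Positive coefficients and positive operators *)

Inductive pos_coef : R -> Prop :=
| pos_coef0 : pos_coef 0
| pos_coef1 : pos_coef 1
| pos_coef_simple k : pos_coef (x k.+1 - x k)
| pos_coefD a b : pos_coef a -> pos_coef b -> pos_coef (a + b)
| pos_coefM a b : pos_coef a -> pos_coef b -> pos_coef (a * b).

Lemma pos_coef_diff k l : (k <= l)%N -> pos_coef (x l - x k).
Proof.
elim: l => [|l IH]; first by rewrite leqn0 => /eqP ->; rewrite subrr; apply: pos_coef0.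
rewrite leq_eqVlt => /orP[/eqP ->|kl]; first by rewrite subrr; apply: pos_coef0.
have -> : x l.+1 - x k = (x l.+1 - x l) + (x l - x k) by ring.
by apply: pos_coefD; [apply: pos_coef_simple|apply: IH].
Qed.

(** The constructor [posop_ext] closes the class under pointwise equality, so functional
    extensionality is avoided. *)
Inductive posop : (R -> R) -> Prop :=
| posop0 : posop (fun=> 0)
| posop_term a w : pos_coef a -> posop (fun f => a * wd w f)
| posopD D1 D2 : posop D1 -> posop D2 -> posop (fun f => D1 f + D2 f)
| posop_ext D1 D2 : D1 =1 D2 -> posop D1 -> posop D2.

(** The sign makes the root a sum of simple differences on either side of [i]. *)
Definition root_to i k := if (k < i)%N then x i - x k else x k - x i.
Definition root_prod i (J : seq nat) := \prod_(k <- J) root_to i k.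

Lemma pos_coef_root_prod i J : pos_coef (root_prod i J).
Proof.
rewrite /root_prod; elim: J => [|k J IH]; first by rewrite big_nil; apply: pos_coef1.
rewrite big_cons; apply: pos_coefM => //; rewrite /root_to.
by case: ltnP => ki; apply: pos_coef_diff; lia.
Qed.

(* Sums of squarefree monomials in the root_to i k, k in A, times words.  Squarefreeness
   is what keeps divided differences of the coefficients positive. *)
Inductive sqfree_op i (A : pred nat) : (R -> R) -> Prop :=
| sqfree_op_term J w : uniq J -> all A J -> sqfree_op i A (fun f => root_prod i J * wd w f)
| sqfree_opD D1 D2 : sqfree_op i A D1 -> sqfree_op i A D2 -> sqfree_op i A (fun f => D1 f + D2 f)
| sqfree_op_ext D1 D2 : D1 =1 D2 -> sqfree_op i A D1 -> sqfree_op i A D2.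

Lemma sqfree_op_sub i (A B : pred nat) D : subpred A B -> sqfree_op i A D -> sqfree_op i B D.
Proof.
move=> AB; elim=> [J w uJ aJ|D1 D2 _ h1 _ h2|D1 D2 e _ h].
- by apply: sqfree_op_term => //; apply: sub_all aJ.
- exact: sqfree_opD.
- exact: sqfree_op_ext e h.
Qed.

Lemma sqfree_op_posop i A D : sqfree_op i A D -> posop D.
Proof.
elim=> [J w _ _|D1 D2 _ h1 _ h2|D1 D2 e _ h].
- by apply: posop_term; apply: pos_coef_root_prod.
- exact: posopD.
- exact: posop_ext e h.
Qed.

Lemma sw_root_prod i a b J : i != a -> i != b -> a \notin J -> b \notin J ->
  sw a b (root_prod i J) = root_prod i J.
Proof.
move=> ia ib aJ bJ; rewrite rmorph_prod; apply: eq_big_seq => k kJ.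
have ka : k != a by apply: contraNneq aJ => <-.
have kb : k != b by apply: contraNneq bJ => <-.
have -> : root_to i k = if (k < i)%N then x i - x k else x k - x i by [].
by case: ifP => _; rewrite rmorphB /= !sw_x; congr (_ - _); index_cases.
Qed.

(** Of the two indices exchanged by [d l], [a] is the one nearer to [i]. Hence [d l] maps its root
    to 1 and the swap maps it to the root of [b]: Leibniz gives two terms without signs. As [b] is
    free, both stay squarefree. *)
Lemma sqfree_op_pass i (A : pred nat) l a b D :
  ((l.+1 < i) && (a == l.+1) && (b == l) || (i < l) && (a == l) && (b == l.+1))%N ->
  ~~ A b -> sqfree_op i A D ->
  sqfree_op i [pred k | (A k && (k != a)) || (k == b)] (fun f => d l (D f)).
Proof.
move=> h Ab; elim=> [J w uJ aJ|D1 D2 _ h1 _ h2|D1 D2 e _ h1]; last 2 first.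
- apply: sqfree_op_ext (sqfree_opD h1 h2) => f /=; by rewrite /d ddD.
- by apply: sqfree_op_ext h1 => f /=; rewrite e.
have [il il1] : i != l /\ i != l.+1 by split; lia.
have ab_l (L : seq nat) : a \notin L -> b \notin L -> l \notin L /\ l.+1 \notin L.
  by case/orP: h => /andP[/andP[_ /eqP ->] /eqP ->].
have bJ : b \notin J by apply: contra Ab => /(allP aJ).
have [aJ'|aJ'] := boolP (a \in J); last first.
  have inv : sw l l.+1 (root_prod i J) = root_prod i J.
    by have [lJ l1J] := ab_l _ aJ' bJ; apply: sw_root_prod.
  apply: (@sqfree_op_ext i _ (fun f => root_prod i J * wd (l :: w) f)) => [f|].
    by rewrite /= /d ddM_inv.
  apply: sqfree_op_term => //; apply/allP => k kJ /=; rewrite (allP aJ) //=.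
  by apply/orP; left; apply: contraNneq aJ' => <-.
set J' := rem a J.
have aJ1 : a \notin J' by rewrite mem_rem_uniq // !inE eqxx.
have bJ1 : b \notin J' by apply: contra bJ; apply: mem_rem.
have inv : sw l l.+1 (root_prod i J') = root_prod i J'.
  by have [lJ l1J] := ab_l _ aJ1 bJ1; apply: sw_root_prod.
have eJ : root_prod i J = root_to i a * root_prod i J' by rewrite /root_prod (big_rem a).
have dy : d l (root_to i a) = 1.
  have dB p q : d l (p - q) = d l p - d l q.
    by apply: ddP => //; rewrite rmorphB mulrBr !ddE; ring.
  have l1l : (l.+1 == l) = false by lia.
  rewrite /root_to; case/orP: h => /andP[/andP[hl /eqP ->] _].
    by rewrite hl dB /d !dd_x // (negbTE il) (negbTE il1) eqxx l1l /=; ring.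
  by rewrite ltnNge (ltnW hl) dB /d !dd_x // (negbTE il) (negbTE il1) eqxx (negbTE (neqS l)) /=; ring.
have sy : sw l l.+1 (root_to i a) = root_to i b.
  rewrite /root_to; case/orP: h => /andP[/andP[? /eqP ?] /eqP ?]; subst.
    rewrite !ifT; [|by lia..]; rewrite rmorphB /= !sw_x; congr (_ - _); index_cases.
  rewrite !ifF; [|by lia..]; rewrite rmorphB /= !sw_x; congr (_ - _); index_cases.
apply: (@sqfree_op_ext i _ (fun f => root_prod i J' * wd w f + root_prod i (b :: J') * wd (l :: w) f)) => [f|].
  rewrite /= eJ -mulrA /d ddM // [dd _ _ (root_to i a)]dy mul1r sy ddM_inv //.
  by rewrite /root_prod big_cons mulrA.
have aJ2 : all [pred k | (A k && (k != a)) || (k == b)] J'.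
  apply/allP => k kJ /=; rewrite (allP aJ) /=; last exact: mem_rem kJ.
  by apply/orP; left; apply: contraNneq aJ1 => <-.
apply: sqfree_opD; apply: sqfree_op_term => //; first exact: rem_uniq.
  by rewrite /= bJ1 rem_uniq.
by rewrite /= eqxx orbT.
Qed.

(** The old coefficient involves neither index and commutes with [dd i i.+2]; the two factors in
    [dd_transposition] are the roots of [i] and [i.+2]. *)
Lemma sqfree_op_insert i (A : pred nat) D : ~~ A i -> ~~ A i.+2 -> sqfree_op i.+1 A D ->
  sqfree_op i.+1 [pred k | [|| A k, k == i | k == i.+2]] (fun f => dd i i.+2 (D f)).
Proof.
have i02 : i != i.+2 by lia.
move=> Ai Ai2; elim=> [J w uJ aJ|D1 D2 _ h1 _ h2|D1 D2 e _ h1]; last 2 first.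
- by apply: sqfree_op_ext (sqfree_opD h1 h2) => f /=; rewrite ddD.
- by apply: sqfree_op_ext h1 => f /=; rewrite e.
have iJ : i \notin J by apply: contra Ai => /(allP aJ).
have i2J : i.+2 \notin J by apply: contra Ai2 => /(allP aJ).
have inv : sw i i.+2 (root_prod i.+1 J) = root_prod i.+1 J by apply: sw_root_prod => //; lia.
have y1 : root_to i.+1 i = x i.+1 - x i by rewrite /root_to ltnSn.
have y2 : root_to i.+1 i.+2 = x i.+2 - x i.+1 by rewrite /root_to ifF //; lia.
apply: (@sqfree_op_ext i.+1 _ (fun f => root_prod i.+1 J * wd (i :: w) f + root_prod i.+1 J * wd (i.+1 :: w) f
  + root_prod i.+1 (i :: J) * wd [:: i, i.+1 & w] f
  + root_prod i.+1 (i.+2 :: J) * wd [:: i.+1, i & w] f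
  + root_prod i.+1 [:: i, i.+2 & J] * wd [:: i, i.+1, i & w] f)) => [f|].
  rewrite ddM_inv // (@dd_transposition i i.+1) //= /root_prod !big_cons y1 y2 /d; ring.
have aJ' : all [pred k | [|| A k, k == i | k == i.+2]] J.
  by apply: sub_all aJ => k /= ->.
by do 4?apply: sqfree_opD; apply: sqfree_op_term; rewrite /= ?inE ?negb_or ?eqxx ?orbT ?iJ ?i2J ?i02.
Qed.

(** * Lifting words through $R_i^-$ *)

Definition lifts i (D' D : R -> R) := forall j f, Rm i j (D' f) = D (Rm i j f).

(** [up i] keeps $l$ and $l+1$ adjacent unless $l = i-1$. *)
Lemma lifts_wd i w : all (fun l => l.+1 != i) w -> lifts i (wd (map (up i) w)) (wd w).
Proof.
move=> aw j f; elim: w aw => //= l w IH /andP[li aw].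
rewrite /d -IH // -Rm_dd //; congr (Rm i j (dd _ _ _)).
by index_cases.
Qed.

Lemma lifts_comp i D1' D1 D2' D2 : lifts i D1' D1 -> lifts i D2' D2 ->
  lifts i (fun f => D1' (D2' f)) (fun f => D1 (D2 f)).
Proof. by move=> h1 h2 j f; rewrite h1 h2. Qed.

(** Left of [i] there is one free index; each letter moves it up by one, from [k] to [M]. *)
Lemma sqfree_op_low i k B M D : (k <= M)%N -> (M < i)%N ->
  sqfree_op i [pred a | (k < a < i) || (i < a) && (B < a)]%N D ->
  sqfree_op i [pred a | (k <= a < i) && (a != M) || (i < a) && (B < a)]%N
    (fun f => wd (map (up i) (Cw k M)) (D f)).
Proof.
elim: M => [|M IH] kM Mi h.
  by move: kM; rewrite leqn0 => /eqP ->; rewrite Cwkk; apply: sqfree_op_sub h => a /=; lia.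
move: kM; rewrite leq_eqVlt => /orP[/eqP <-|kM].
  by rewrite Cwkk; apply: sqfree_op_sub h => a /=; lia.
rewrite CwS //=; have -> : up i M = M by rewrite /up ifT //; lia.
have := @sqfree_op_pass i _ M M.+1 M _ _ _ (IH kM (ltnW Mi) h).
move/(_ _ _)/sqfree_op_sub; apply => //=; try lia.
by move=> a /=; lia.
Qed.

(** Right of [i] one admissible index climbs from $i+1$ to $N+1$; the others there exceed [B], so it
    meets none of them. *)
Lemma sqfree_op_high i k B N D : (i <= N)%N -> (N < B)%N ->
  sqfree_op i [pred a | [|| k <= a < i, a == i.+1 | (i < a) && (B < a)]]%N D ->
  sqfree_op i [pred a | [|| k <= a < i, a == N.+1 | (i < a) && (B < a)]]%N
    (fun f => wd (map (up i) (Cw i N)) (D f)).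
Proof.
elim: N => [|N IH] iN NB h.
  by move: iN; rewrite leqn0 => /eqP i0; rewrite i0 Cwkk in h *.
move: iN; rewrite leq_eqVlt => /orP[/eqP <-|iN].
  by rewrite Cwkk.
rewrite CwS //=; have -> : up i N = N.+1 by rewrite /up ifF //; lia.
have := @sqfree_op_pass i _ N.+1 N.+1 N.+2 _ _ _ (IH iN (ltnW NB) h).
move/(_ _ _)/sqfree_op_sub; apply => //=; try lia.
by move=> a /=; lia.
Qed.

(** Blocks are added from last to first. Since their upper bounds increase strictly, the indices
    already used on the right leave room for the next block. *)
Lemma normal_form_lift i k L w : normal_form i k L w ->
  exists2 D, lifts i D (wd w) & sqfree_op i [pred a | (k <= a < i) || (i < a) && (L < a)]%N D.
Proof.
elim=> [{}L {}w aw|{}k {}L M {}w ki kM LM h [D hD cD]].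
  exists (wd (map (up i) w)); first exact: lifts_wd.
  apply: (@sqfree_op_ext _ _ (fun f => root_prod i [::] * wd (map (up i) w) f)).
    by move=> f; rewrite /root_prod big_nil mul1r.
  exact: sqfree_op_term.
have [Mi|iM] := ltnP M i.
  exists (fun f => wd (map (up i) (Cw k M)) (D f)).
    move=> j f; rewrite wd_cat; apply: lifts_comp j f => //; apply: lifts_wd.
    by apply/allP => l; rewrite mem_Cw; lia.
  by apply: sqfree_op_sub (sqfree_op_low kM Mi cD) => a /=; lia.
(* The block now contains the exceptional letter; after renaming, that letter is [i] and the removed
   slot is [i.+1]. *)
case: i ki iM {h} hD cD => // i ki iM hD cD.
have kle : (k <= i)%N by [].
exists (fun f => wd (map (up i.+1) (Cw i.+1 M))
   (dd i i.+2 (wd (map (up i.+1) (Cw k i)) (D f)))).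
  have eC : Cw k M = Cw i.+1 M ++ i :: Cw k i.
    by rewrite (@Cw_cat k i.+1) ?CwS //; lia.
  move=> j f; rewrite eC !wd_cat /=.
  rewrite (@lifts_wd i.+1 (Cw i.+1 M)); last by apply/allP => l; rewrite mem_Cw; lia.
  have -> : dd i i.+2 = dd (up i.+1 i) (up i.+1 i.+1) by congr dd; index_cases.
  rewrite Rm_dd // -/(d i _) (@lifts_wd i.+1 (Cw k i)) ?hD //.
  by apply/allP => l; rewrite mem_Cw; lia.
(* The lower segment frees index [i], [dd i i.+2] occupies [i] and [i.+2], and the upper segment
   drives [i.+2] up to [M.+1], beyond [L]. *)
have c1 := sqfree_op_low kle (ltnSn i) cD.
have c2 := sqfree_op_insert (i := i) _ _ c1.
have c3 : sqfree_op i.+1 [pred a | [|| k <= a < i.+1, a == i.+2 | (i.+1 < a) && (M.+1 < a)]]%N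
    (fun f => dd i i.+2 (wd (map (up i.+1) (Cw k i)) (D f))).
  by apply: sqfree_op_sub (c2 _ _) => /=; [move=> a /=; lia|lia|lia].
by apply: sqfree_op_sub (sqfree_op_high iM (ltnSn M) c3) => a /=; lia.
Qed.

Theorem word_lift_posop i w : exists2 D, posop D & lifts i D (wd w).
Proof.
have [e0|[w' h e]] := normal_form_exists i w.
  by exists (fun=> 0); [apply: posop0|move=> j f; rewrite rmorph0 e0].
have [D hD cD] := normal_form_lift h; exists D; first exact: sqfree_op_posop cD.
by move=> j f; rewrite hD e.
Qed.

Lemma posop_scale a D : pos_coef a -> posop D -> posop (fun f => a * D f).
Proof.
move=> ga; elim=> [|b w gb|D1 D2 _ h1 _ h2|D1 D2 e _ h].
- by apply: posop_ext posop0 => f; rewrite mulr0.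
- apply: (posop_ext (D1 := fun f => (a * b) * wd w f)) => [f|]; first by rewrite mulrA.
  by apply: posop_term; apply: pos_coefM.
- by apply: posop_ext (posopD h1 h2) => f; rewrite mulrDr.
- by apply: posop_ext h => f; rewrite e.
Qed.

Lemma posop_d i D : posop D -> posop (fun f => D (d i f)).
Proof.
elim=> [|b w gb|D1 D2 _ h1 _ h2|D1 D2 e _ h].
- exact: posop0.
- apply: (posop_ext (D1 := fun f => b * wd (rcons w i) f)) => [f|].
    by rewrite -cats1 wd_cat.
  exact: posop_term.
- exact: posopD.
- by apply: posop_ext h => f; rewrite e.
Qed.

Lemma Rm_up i j k : Rm i j (x (up i k)) = x k.
Proof. by rewrite /Rm sx_x; index_cases. Qed.

(** A simple difference lifts to the difference of two consecutive values of [up i], again a sum of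
    simple differences. *)
Lemma pos_coef_lift i a : pos_coef a -> exists2 b, pos_coef b & forall j, Rm i j b = a.
Proof.
elim=> [||k|a1 a2 _ [b1 g1 e1] _ [b2 g2 e2]|a1 a2 _ [b1 g1 e1] _ [b2 g2 e2]].
- by exists 0 => [|j]; [apply: pos_coef0|rewrite rmorph0].
- by exists 1 => [|j]; [apply: pos_coef1|rewrite rmorph1].
- exists (x (up i k.+1) - x (up i k)); first by apply: pos_coef_diff; index_cases.
  by move=> j; rewrite rmorphB /= !Rm_up.
- by exists (b1 + b2) => [|j]; [apply: pos_coefD|rewrite rmorphD e1 e2].
- by exists (b1 * b2) => [|j]; [apply: pos_coefM|rewrite rmorphM e1 e2].
Qed.

Lemma posop_lifts i D : posop D -> exists2 D', posop D' & lifts i D' D.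
Proof.
elim=> [|a w ga|D1 D2 _ [D1' p1 h1] _ [D2' p2 h2]|D1 D2 e _ [D' p h]].
- by exists (fun=> 0); [apply: posop0|move=> j f; rewrite rmorph0].
- have [b gb eb] := pos_coef_lift i ga; have [D' pD hD] := word_lift_posop i w.
  exists (fun f => b * D' f); first exact: posop_scale.
  by move=> j f; rewrite rmorphM /= eb hD.
- exists (fun f => D1' f + D2' f); first exact: posopD.
  by move=> j f; rewrite rmorphD /= h1 h2.
- by exists D' => // j f; rewrite h e.
Qed.

(** * The operators attached to trees and forests *)

(* Leaves are numbered from off, so (off + nleaves l).-1 is the last leaf of l. *)
Fixpoint DT (off : nat) T f : R :=
  match T with
  | Leaf => f
  | Node l r => dd (off + nleaves l).-1 (off + nleaves l + nleaves r).-1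
                   (DT off l (DT (off + nleaves l)%N r f))
  end.

Fixpoint DF (off : nat) (F : forest) f : R :=
  if F is T :: F' then DT off T (DF (off + nleaves T)%N F' f) else f.

Lemma node_neq off l r : (off + nleaves l).-1 != (off + nleaves l + nleaves r).-1.
Proof. by have := nleaves_gt0 l; have := nleaves_gt0 r; lia. Qed.
Local Hint Resolve node_neq : core.

(** Freeness from the x-variables, phrased by substitutions because the ring is abstract. *)
Definition tconst c := forall s, sx s c = c.

Lemma DT_linear off T c f g : tconst c -> DT off T (c * f + g) = c * DT off T f + DT off T g.
Proof.
move=> tc; elim: T off f g => //= l IHl r IHr off f g.
by rewrite IHr IHl ddD // ddM_inv //; apply: tc.
Qed.

Lemma DF_linear off F c f g : tconst c -> DF off F (c * f + g) = c * DF off F f + DF off F g.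
Proof. by move=> tc; elim: F off => //= T F IH off; rewrite IH DT_linear. Qed.

Lemma tconst1 : tconst 1. Proof. by move=> s; rewrite rmorph1. Qed.

Lemma DF_D off F f g : DF off F (f + g) = DF off F f + DF off F g.
Proof. by rewrite -{1}[f]mul1r DF_linear ?mul1r //; apply: tconst1. Qed.

Lemma DF_0 off F : DF off F 0 = 0.
Proof. by apply: (@addIr _ (DF off F 0)); rewrite -DF_D !add0r. Qed.

Definition skip_t i : {rmorphism R -> R} := sub x (fun k => if (k < i)%N then t k else t k.+1).

Lemma skip_t_dd i a b f : a != b -> skip_t i (dd a b f) = dd a b (skip_t i f).
Proof.
move=> ab; apply: dd_natural => // k; first by rewrite sw_x.
by case: ifP => _; rewrite sx_t.
Qed.

Lemma skip_t_DT i off T f : skip_t i (DT off T f) = DT off T (skip_t i f).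
Proof. by elim: T off f => //= l IHl r IHr off f; rewrite skip_t_dd // IHl IHr. Qed.

Lemma skip_t_DF i off F f : skip_t i (DF off F f) = DF off F (skip_t i f).
Proof. by elim: F off => //= T F IH off; rewrite skip_t_DT IH. Qed.

Lemma DT_d i off T f : ((i.+1 < off) || (off + nleaves T <= i))%N ->
  d i (DT off T f) = DT off T (d i f).
Proof.
elim: T off f => //= l IHl r IHr off f h.
have := nleaves_gt0 l; have := nleaves_gt0 r => r0 l0.
have dC a b g : i != a -> i != b -> i.+1 != a -> i.+1 != b -> a != b ->
    d i (dd a b g) = dd a b (d i g) by move=> *; apply: dd_comm.
rewrite dC; [|lia..].
by rewrite IHl ?IHr //; lia.
Qed.

Lemma DF_d i off F f : (i.+1 < off)%N -> d i (DF off F f) = DF off F (d i f).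
Proof.
elim: F off => //= T F IH off h; rewrite DT_d ?h // IH //; lia.
Qed.

Lemma DT_Rm_right i j off T f : (i < off)%N ->
  Rm i j (DT off T f) = DT off.-1 T (Rm i j f).
Proof.
elim: T off f => //= l IHl r IHr off f h.
have := nleaves_gt0 l; have := nleaves_gt0 r => r0 l0.
have -> : DT (off.-1 + nleaves l)%N r = DT (off + nleaves l).-1 r by congr DT; lia.
rewrite -IHr; last by lia.
rewrite -IHl // -Rm_dd; last by lia.
by congr (Rm i j (dd _ _ _)); index_cases.
Qed.

Lemma DT_Rm_left i j off T f : (off + nleaves T <= i)%N ->
  Rm i j (DT off T f) = DT off T (Rm i j f).
Proof.
elim: T off f => //= l IHl r IHr off f h.
have := nleaves_gt0 l; have := nleaves_gt0 r => r0 l0.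
rewrite -IHr; last by lia.
rewrite -IHl; last by lia.
rewrite -Rm_dd //.
by congr (Rm i j (dd _ _ _)); index_cases.
Qed.

Lemma DF_Rm_right i j off F f : (i < off)%N ->
  Rm i j (DF off F f) = DF off.-1 F (Rm i j f).
Proof.
elim: F off => //= T F IH off h; rewrite DT_Rm_right // IH; last by lia.
by congr (DT _ _ (DF _ _ _)); lia.
Qed.

(** The terminal node contributes [d i]. No other node uses index [i], since a last leaf of a
    subtree is never the left leaf of a terminal node; so $R_i^-$ merely renumbers the other
    operators. *)
Lemma DT_del i j off T f : i \in tqdes off T ->
  Rm i j (DT off T f) = DT off (tdel off i T) (Rm i j (d i f)).
Proof.
elim: T off f => // l IHl r IHr off f; rewrite tqdesN tdelN.
case: ifP => [/andP[]|_].
  case: l {IHl} => // _; case: r {IHr} => // _; rewrite mem_seq1 eq_sym => /eqP -> /=.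
  by rewrite eqxx /= /d; congr (Rm i j (dd _ _ _)); lia.
have := nleaves_gt0 l; have := nleaves_gt0 r => r0 l0.
rewrite mem_cat; case: (boolP (i \in tqdes off l)) => /= [il _|il ir].
  have := tqdes_bound il; have := nleaves_tdel il => e b.
  rewrite (@tdel_id _ r); last by apply/negP => /tqdes_bound; lia.
  have -> : (off + nleaves (tdel off i l) = (off + nleaves l).-1)%N by lia.
  rewrite -DT_Rm_right; last by lia.
  rewrite -DT_d; last by lia.
  rewrite -IHl // -Rm_dd; last by lia.
  by congr (Rm i j (dd _ _ _)); index_cases.
have := tqdes_bound ir; have := nleaves_tdel ir => e b.
rewrite (@tdel_id _ l) // -IHr //.
rewrite -DT_Rm_left; last by lia.
have := nleaves_gt0 (tdel (off + nleaves l) i r) => r1.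
rewrite -Rm_dd; last by lia.
by congr (Rm i j (dd _ _ _)); index_cases.
Qed.

Lemma DF_del i j off F f : i \in fqdes off F ->
  Rm i j (DF off F f) = DF off (fdel off i F) (Rm i j (d i f)).
Proof.
elim: F off f => // T F IH off f /=; rewrite mem_cat.
case: (boolP (i \in tqdes off T)) => /= [iT _|iT iF].
  have := tqdes_bound iT; have := nleaves_tdel iT => e b.
  rewrite fdel_id; last by apply/negP => /fqdes_bound; lia.
  have -> : (off + nleaves (tdel off i T) = (off + nleaves T).-1)%N by lia.
  rewrite -DF_Rm_right; last by lia.
  rewrite -DF_d; last by lia.
  by rewrite -DT_del.
have := fqdes_bound iF => b.
by rewrite tdel_id // -IH // -DT_Rm_left.
Qed.

Lemma DF_strip off F f : DF off (strip F) f = DF off F f.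
Proof.
have [n e] := strip_decomp F; rewrite {2}e.
elim: (strip F) off => [|T G IH] off /=; last by rewrite IH.
by elim: n off {e} => //= n IH off; rewrite -IH.
Qed.

(** The recursion behind positivity, separation and duality; by [Rm_d], [Rm i (tau i) (d i f)] is
    $E_i f$ with parameter $t_{\tau(i)}$. *)
Lemma ev_DF_del tau i F f : i \in Qdes F ->
  ev tau (DF 0 F f) = ev (fun k => tau (up i k)) (DF 0 (fquot F i) (Rm i (tau i) (d i f))).
Proof. by move=> iF; rewrite (ev_Rm tau i) DF_del // DF_strip. Qed.

(** Induction on nodes: the operator for $F/i$ lifts through $R_i^-$ and is composed with [d i]. All
    [tau] are treated at once, because trimming changes [tau]. *)
Lemma DF_posop F : canon F ->
  exists2 D, posop D & forall tau f, ev tau (DF 0 F f) = ev tau (D f).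
Proof.
have [n] := ubnP (nnodes F); elim: n F => // n IH F; rewrite ltnS => Fn cF.
have [->|/eqP nF] := eqVneq F [::].
  exists (fun f => 1 * wd [::] f); first by apply: posop_term; apply: pos_coef1.
  by move=> tau f; rewrite mul1r.
have [i iF] := Qdes_nonempty cF nF.
have [|D pD eD] := IH (fquot F i) _ (fquot_canon F i).
  by have := nnodes_fquot iF; lia.
have [D' pD' hD'] := posop_lifts i pD.
exists (fun f => D' (d i f)); first exact: posop_d.
by move=> tau f; rewrite (ev_DF_del _ _ iF) eD -hD' -(ev_Rm tau i).
Qed.

(** * The operators $E_i$, bounds on degree and variables, and separation *)

Definition Rp i j : {rmorphism R -> R} :=
  sx (fun k => if (k <= i)%N then x k else if k == i.+1 then t j else x k.-1).

(** Apply $R_i^+$ to the equation defining [d i f]: it turns the swap of [f] into $R_i^- f$, and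
    agrees with $R_i^-$ on the symmetric [d i f]. *)
Lemma Rm_d i j f : (x i - t j) * Rm i j (d i f) = Rp i j f - Rm i j f.
Proof.
have e : Rp i j (sw i i.+1 f) = Rm i j f.
  by rewrite /Rp /Rm /sw sx_comp; apply: sx_ext => k; rewrite sx_x; index_cases.
have e' : Rm i j (d i f) = Rp i j (d i f).
  rewrite /d -[in RHS](dd_sym f (neqS i)).
  by rewrite /Rp /Rm /sw sx_comp; apply: sx_ext => k; rewrite sx_x; index_cases.
rewrite e' -e -rmorphB -ddE rmorphM rmorphB /= /Rp !sx_x.
by rewrite leqnn ltnn eqxx.
Qed.

Lemma ev_skip_t i p : ev (up i) (skip_t i p) = skip_t i (ev id p).
Proof.
rewrite /ev /skip_t /sx !sub_comp; apply: sub_ext => k; rewrite ?sub_x ?sub_t /up;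
 by case: ifP => _; rewrite ?sub_t.
Qed.

(** The bound is strict, so that bound 0 forces the zero polynomial. *)
Inductive xdeg_lt : nat -> R -> Prop :=
| xdeg_lt_0 m : xdeg_lt m 0
| xdeg_lt_const m c : tconst c -> xdeg_lt m.+1 c
| xdeg_lt_D m p q : xdeg_lt m p -> xdeg_lt m q -> xdeg_lt m (p + q)
| xdeg_lt_x m i p : xdeg_lt m p -> xdeg_lt m.+1 (x i * p)
| xdeg_lt_S m p : xdeg_lt m p -> xdeg_lt m.+1 p.

Lemma xdeg_lt_eq0 p : xdeg_lt 0 p -> p = 0.
Proof.
move: {-2}0%N (erefl 0%N) => m m0 h.
elim: h m0 => // {}m q r _ hq _ hr /[dup] /hq -> /hr ->; exact: addr0.
Qed.

Lemma xdeg_lt_le m n p : (m <= n)%N -> xdeg_lt m p -> xdeg_lt n p.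
Proof. by move/subnK <- => h; elim: (n - m)%N => // k IH; apply: xdeg_lt_S. Qed.

Lemma xdeg_lt_scale m c p : tconst c -> xdeg_lt m p -> xdeg_lt m (c * p).
Proof.
move=> tc; elim=> {m p} [m|m c' tc'|m p q _ hp _ hq|m i p _ hp|m p _ hp].
- by rewrite mulr0; apply: xdeg_lt_0.
- by apply: xdeg_lt_const => s; rewrite rmorphM tc tc'.
- by rewrite mulrDr; apply: xdeg_lt_D.
- by rewrite mulrCA; apply: xdeg_lt_x.
- exact: xdeg_lt_S.
Qed.

Lemma tconst_t i : tconst (t i). Proof. by move=> s; rewrite sx_t. Qed.

Lemma xdeg_lt_Rm m i j p : xdeg_lt m p -> xdeg_lt m (Rm i j p).
Proof.
elim=> {m p} [m|m c tc|m p q _ hp _ hq|m k p _ hp|m p _ hp].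
- by rewrite rmorph0; apply: xdeg_lt_0.
- by rewrite tc; apply: xdeg_lt_const.
- by rewrite rmorphD; apply: xdeg_lt_D.
- rewrite rmorphM /= /Rm sx_x -/(Rm i j); case: ifP => _; first exact: xdeg_lt_x.
  case: ifP => _; last exact: xdeg_lt_x.
  by apply: xdeg_lt_S; apply: xdeg_lt_scale => //; apply: tconst_t.
- exact: xdeg_lt_S.
Qed.

Lemma xdeg_lt_dd m a b p : a != b -> xdeg_lt m p -> xdeg_lt m.-1 (dd a b p).
Proof.
move=> ab; elim=> {m p} [m|m c tc|m p q _ hp _ hq|m k p h hp|m p h hp] /=.
- by rewrite dd0 //; apply: xdeg_lt_0.
- by rewrite dd_inv //; [apply: xdeg_lt_0|apply: tc].
- by rewrite ddD //; apply: xdeg_lt_D.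
- rewrite ddM //; apply: xdeg_lt_D.
    by apply: xdeg_lt_scale => // s; rewrite dd_x // rmorphB !rmorph_nat.
  (* At [m = 0] the predecessor is 0 again, which forces [dd a b p] to vanish. *)
  rewrite sw_x; case: m h hp => [|m] h hp; last exact: xdeg_lt_x.
  by rewrite (xdeg_lt_eq0 hp) mulr0; apply: xdeg_lt_0.
- by apply: xdeg_lt_le hp; apply: leq_pred.
Qed.

Lemma xdeg_lt_DT m off T f : xdeg_lt m f -> xdeg_lt (m - (nleaves T).-1) (DT off T f).
Proof.
elim: T m off f => [|l IHl r IHr] m off f h /=; first by rewrite subn0.
have := nleaves_gt0 l; have := nleaves_gt0 r => r0 l0.
apply: xdeg_lt_le (xdeg_lt_dd _ (IHl _ off _ (IHr _ (off + nleaves l)%N _ h))) => //; lia.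
Qed.

Lemma xdeg_lt_DF m off F f : xdeg_lt m f -> xdeg_lt (m - nnodes F) (DF off F f).
Proof.
elim: F off => [|T F IH] off h /=; first by rewrite subn0.
by apply: xdeg_lt_le (xdeg_lt_DT off T (IH (off + nleaves T)%N h)); rewrite /nnodes /=; lia.
Qed.

Lemma xdeg_lt_exists p : exists m, xdeg_lt m p.
Proof.
elim/poly_ind: p => [c|p q [m hp] [n hq]|i p [m hp]|i p [m hp]].
- by exists 1%N; apply: xdeg_lt_const => s; rewrite rmorph_int.
- exists (m + n)%N; apply: xdeg_lt_D; [apply: xdeg_lt_le hp|apply: xdeg_lt_le hq]; lia.
- by exists m.+1; apply: xdeg_lt_x.
- by exists m; apply: xdeg_lt_scale => //; apply: tconst_t.
Qed.

(** [xtrunc N p = p] says that [p] involves only the $x_k$ with $k < N$. *)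
Definition xtrunc N : {rmorphism R -> R} := sx (fun k => if (k < N)%N then x k else 0).

Lemma xtrunc_le M N p : (M <= N)%N -> xtrunc M p = p -> xtrunc N p = p.
Proof.
move=> MN <-; rewrite /xtrunc sx_comp; apply: sx_ext => k.
by case: ifP => kM; rewrite ?rmorph0 // sx_x ifT //; lia.
Qed.

Lemma xtrunc_exists p : exists N, xtrunc N p = p.
Proof.
elim/poly_ind: p => [c|p q [m hp] [n hq]|i p [m hp]|i p [m hp]].
- by exists 0%N; rewrite rmorph_int.
- exists (m + n)%N; rewrite rmorphD (xtrunc_le _ hp) ?(xtrunc_le _ hq) //; lia.
- exists (m + i.+1)%N; rewrite rmorphM (xtrunc_le _ hp); last by lia.
  by rewrite /= /xtrunc sx_x ifT //; lia.
- by exists m; rewrite rmorphM hp /= /xtrunc sx_t.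
Qed.

Lemma xtrunc0_tconst p : xtrunc 0 p = p -> tconst p.
Proof.
move=> e s; rewrite -{1}e /xtrunc sx_comp -[RHS]e; apply: sx_ext => k /=.
by rewrite rmorph0.
Qed.

Lemma xtrunc_d N i f : xtrunc N f = f -> (N <= i)%N -> d i f = 0.
Proof.
move=> e Ni; apply: dd_inv => //; rewrite -e /sw /xtrunc sx_comp; apply: sx_ext => k.
by case: ifP => kN; rewrite ?rmorph0 // sx_x; index_cases.
Qed.

(** Variables are eliminated from the top: if $x_N$ is the last possible one, $R_N^+$ fixes [g]
    while $R_N^-$ replaces $x_N$ by a parameter. *)
Lemma trim_invariant_tconst (tau : nat -> nat) g :
  (forall i, Rp i (tau i) g = Rm i (tau i) g) -> tconst g.
Proof.
move=> h; apply: xtrunc0_tconst; have [N] := xtrunc_exists g; elim: N => // N IH e; apply: IH.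
have e1 : Rm N (tau N) g = g.
  rewrite -h -[RHS]e -{1}e /Rp /xtrunc sx_comp; apply: sx_ext => k.
  by case: ifP => kN; rewrite ?rmorph0 // sx_x ifT //; lia.
rewrite -{1}e1 -{1}e -[RHS]e1 -[in RHS]e /Rm /xtrunc !sx_comp; apply: sx_ext => k.
case: ifP => kN; last by rewrite !rmorph0.
rewrite !sx_x; case: ifP => kN'; first by rewrite sx_x kN'.
by rewrite ifT ?sx_t //; lia.
Qed.

(** Induction on x-degree: every $E_i g$ satisfies the hypothesis for shifted [tau], hence vanishes.
    So [g] is free of x, and the empty forest gives $g = 0$. *)
Lemma separation tau g : (forall F, canon F -> ev tau (DF 0 F g) = 0) -> g = 0.
Proof.
have [m] := xdeg_lt_exists g; elim: m tau g => [|m IH] tau g hg h; first exact: xdeg_lt_eq0.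
have tg : tconst g.
  apply: (@trim_invariant_tconst tau) => i; apply/eqP; rewrite -subr_eq0 -Rm_d.
  rewrite (IH (fun k => tau (up i k)) (Rm i (tau i) (d i g))) ?mulr0 //.
    by apply: xdeg_lt_Rm; apply: xdeg_lt_dd hg.
  move=> F cF; have [G [cG iG <-]] := exists_fquot i cF.
  by rewrite -(ev_DF_del _ _ iG) h.
by rewrite -(tg (fun k => t (tau k))); apply: (h [::]).
Qed.

Lemma ev_tconst tau p : tconst (ev tau p).
Proof. by move=> s; rewrite /ev sx_comp; apply: sx_ext => k; rewrite sx_t. Qed.

(** The x-degree of [f] bounds the nodes of [F], and its last x-variable bounds the number of
    trees. *)
Lemma DF_finite f : exists fs : seq forest,
  forall F tau, canon F -> ev tau (DF 0 F f) != 0 -> F \in fs.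
Proof.
have [m hm] := xdeg_lt_exists f; have [N hN] := xtrunc_exists f.
exists (forests m N) => F tau cF nz; apply: mem_forests.
  case: (canon_decomp cF) nz => [->|[G [l [r ->]]]] //.
  (* A terminal node [q] of the last tree satisfies $q \ge$ [size G]; if $q \ge N$, then [d q f] is
     0. *)
  rewrite -cats1 => nz; have [q hq] := tqdes_Node (nleavesF G) l r.
  have qQ : q \in Qdes (G ++ [:: Node l r]).
    by rewrite /Qdes fqdes_cat mem_cat /= cats0 add0n hq orbT.
  have sG : (size G <= nleavesF G)%N.
    by elim: (G) => //= T H IHH; rewrite /nleavesF /= -/(nleavesF H); have := nleaves_gt0 T; lia.
  have := tqdes_bound hq; rewrite size_cat /= addn1.
  case: (ltnP q N) => qN; first by lia.
  by move: nz; rewrite (ev_DF_del _ _ qQ) (xtrunc_d hN qN) rmorph0 DF_0 rmorph0 eqxx.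
rewrite leqNgt; apply: contra nz => mF; have := xdeg_lt_DF 0 F hm.
have -> : (m - nnodes F = 0)%N by lia.
by move/xdeg_lt_eq0 ->; rewrite rmorph0.
Qed.

(** Words keep [p] inside [Sch], where evaluation lands in [gp]; the coefficients evaluate to sums
    of products of $t_{k+1} - t_k$. *)
Lemma graham_DF (gp : R -> Prop) (Sch : R -> Prop) :
  gp 0 -> gp 1 -> (forall k, gp (t k.+1 - t k)) ->
  (forall a b, gp a -> gp b -> gp (a + b)) -> (forall a b, gp a -> gp b -> gp (a * b)) ->
  (forall p i, Sch p -> Sch (d i p)) -> (forall p, Sch p -> gp (ev id p)) ->
  forall F p, canon F -> Sch p -> gp (ev id (DF 0 F p)).
Proof.
move=> gp0 gp1 gpt gpD gpM Sd Sev F p cF Sp; have [D pD ->] := DF_posop cF.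
have gpa a : pos_coef a -> gp (ev id a).
  elim=> [||k|a1 a2 _ h1 _ h2|a1 a2 _ h1 _ h2]; first by rewrite rmorph0.
  - by rewrite rmorph1.
  - by rewrite rmorphB /= /ev !sx_x; apply: gpt.
  - by rewrite rmorphD; apply: gpD.
  - by rewrite rmorphM; apply: gpM.
elim: pD => {D} [|a w ga|D1 D2 _ h1 _ h2|D1 D2 e _ h].
- by rewrite rmorph0.
- rewrite rmorphM; apply: gpM; first exact: gpa.
  by apply: Sev; elim: w => //= l w IHw; apply: Sd.
- by rewrite rmorphD; apply: gpD.
- by rewrite -e.
Qed.

(** * Duality and expansion in double forest polynomials *)

Section ForestFamily.
Variable P : forest -> R.
Hypothesis P_ev : forall F, canon F -> ev id (P F) = (F == [::])%:R.
Hypothesis P_trim : forall F i, canon F -> Rp i i (P F) - Rm i i (P F) =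
  if i \in Qdes F then (x i - t i) * skip_t i (P (fquot F i)) else 0.

(** Trim both forests at a terminal leaf [i] of [F]. If [i] is terminal in [G] too, [fquot_inj]
    compares the trimmed forests; otherwise $E_i$ kills [P G], and $F \ne G$. *)
Lemma forest_dual F G : canon F -> canon G -> ev id (DF 0 F (P G)) = (F == G)%:R.
Proof.
have [n] := ubnP (nnodes F); elim: n F G => // n IH F G; rewrite ltnS => Fn cF cG.
have [->|/eqP nF] := eqVneq F [::]; first by rewrite /= P_ev // eq_sym.
have [i iF] := Qdes_nonempty cF nF; rewrite (ev_DF_del _ _ iF).
have := Rm_d i i (P G); rewrite P_trim //; case: ifP => iG.
  move/xt_diff_lreg => /= ->.
  rewrite -skip_t_DF ev_skip_t IH ?rmorph_nat //; try exact: fquot_canon; last first.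
    by have := nnodes_fquot iF; lia.
  congr (_%:R); congr nat_of_bool.
  by apply/eqP/eqP => [|->] //; apply: fquot_inj.
rewrite -(mulr0 (x i - t i)) => /xt_diff_lreg /= ->.
rewrite DF_0 rmorph0; case: eqP => // FG.
by move: iG; rewrite -FG iF.
Qed.

(** By duality, all functionals vanish on the difference of the two sides; [separation]
    concludes. *)
Lemma forest_expansion f : exists fs : seq forest,
  [/\ uniq fs, (forall F, F \in fs -> canon F) &
      f = \sum_(F <- fs) ev id (DF 0 F f) * P F].
Proof.
have [fs0 h0] := DF_finite f.
pose fs := [seq F <- undup fs0 | strip F == F]; exists fs.
have cfs F : F \in fs -> canon F by rewrite mem_filter => /andP[/eqP].
have ufs : uniq fs by rewrite filter_uniq // undup_uniq.
split=> //; apply/eqP; rewrite -subr_eq0; apply/eqP/(@separation id) => G cG.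
have sumE (gs : seq forest) : (forall F, F \in gs -> canon F) ->
    ev id (DF 0 G (\sum_(F <- gs) ev id (DF 0 F f) * P F)) =
    \sum_(F <- gs) ev id (DF 0 F f) * (G == F)%:R.
  elim: gs => [|F gs IH] cgs; first by rewrite !big_nil DF_0 rmorph0.
  rewrite !big_cons DF_linear; last exact: ev_tconst.
  rewrite rmorphD rmorphM /= ev_tconst forest_dual //; last exact/cgs/mem_head.
  by rewrite IH // => H hH; apply: cgs; rewrite inE hH orbT.
rewrite -[- _]mulN1r addrC DF_linear; last by move=> s; rewrite rmorphN rmorph1.
rewrite rmorphD rmorphM /= rmorphN rmorph1 sumE // mulN1r addrC.
have [Gfs|Gfs] := boolP (G \in fs).
  rewrite (bigD1_seq G) //= eqxx mulr1 big1 ?addr0 ?subrr // => F /negbTE.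
  by rewrite eq_sym => ->; rewrite mulr0.
have -> : ev id (DF 0 G f) = 0.
  apply/eqP; apply: contraNT Gfs => nz; rewrite mem_filter mem_undup (h0 _ _ cG nz) andbT.
  exact/eqP.
rewrite big_seq big1 ?subr0 // => F Ffs; case: eqP Ffs => [<-|_ _]; last by rewrite mulr0.
by rewrite (negbTE Gfs).
Qed.

(** Coefficients free of x pull out of the functional, so duality reads them off any given
    expansion. *)
Lemma forest_coef fs (c : forest -> R) F : uniq fs ->
  (forall G, G \in fs -> canon G /\ tconst (c G)) -> F \in fs ->
  ev id (DF 0 F (\sum_(G <- fs) c G * P G)) = c F.
Proof.
move=> ufs hfs Ffs; have [cF tF] := hfs F Ffs.
have sumE (gs : seq forest) : (forall G, G \in gs -> canon G /\ tconst (c G)) ->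
    ev id (DF 0 F (\sum_(G <- gs) c G * P G)) = \sum_(G <- gs) c G * (F == G)%:R.
  elim: gs => [|G gs IH] cgs; first by rewrite !big_nil DF_0 rmorph0.
  have [cG tG] := cgs G (mem_head _ _).
  rewrite !big_cons DF_linear // rmorphD rmorphM /= tG forest_dual //.
  by rewrite IH // => H hH; apply: cgs; rewrite inE hH orbT.
rewrite sumE // (bigD1_seq F) //= eqxx mulr1 big1 ?addr0 // => G /negbTE.
by rewrite eq_sym => ->; rewrite mulr0.
Qed.

Theorem graham_positive_expansion (gp Sch : R -> Prop) :
  gp 0 -> gp 1 -> (forall k, gp (t k.+1 - t k)) ->
  (forall a b, gp a -> gp b -> gp (a + b)) -> (forall a b, gp a -> gp b -> gp (a * b)) ->
  (forall p i, Sch p -> exists2 q, Sch q & (x i - x i.+1) * q = p - sw i i.+1 p) ->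
  (forall p, Sch p -> gp (ev id p)) ->
  forall f, Sch f ->
  (exists (fs : seq forest) (c : forest -> R),
    [/\ uniq fs, (forall F, F \in fs -> canon F), (forall F, exists q, c F = ev id q) &
        f = \sum_(F <- fs) c F * P F]) /\
  (forall (fs : seq forest) (c : forest -> R), uniq fs ->
    (forall F, F \in fs -> canon F /\ tconst (c F)) -> f = \sum_(F <- fs) c F * P F ->
    forall F, F \in fs -> gp (c F)).
Proof.
move=> gp0 gp1 gpt gpD gpM Sd Sev f Sf; split.
  have [fs [ufs cfs ef]] := forest_expansion f.
  by exists fs, (fun F => ev id (DF 0 F f)); split=> // F; exists (DF 0 F f).
move=> fs c ufs hfs ef F Ffs; rewrite -(forest_coef ufs hfs Ffs) -ef.
apply: (graham_DF gp0 gp1 gpt gpD gpM _ Sev) => //; last by case: (hfs _ Ffs).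
by move=> p i /(Sd p i)[q Sq e]; rewrite /d (ddP (neqS i) e).
Qed.

End ForestFamily.

End Operators.

(** * Graham positivity *)

Definition dring : comNzRingType := dpoly.
Definition dX (i : nat) : dring := X i.
Definition dT (i : nat) : dring := T i.

Definition dsub (s r : nat -> dring) : {rmorphism dring -> dring} :=
  @eval var dring (@malgC (cmonom var) int)
    (fun v => match v with inl i => s i | inr i => r i end).

Lemma dsub_X s r i : dsub s r (dX i) = s i.
Proof. exact: (@eval_var var dring). Qed.

Lemma dsub_T s r i : dsub s r (dT i) = r i.
Proof. exact: (@eval_var var dring). Qed.

Lemma dring_ext (f g : {rmorphism dring -> dring}) :
  (forall i, f (dX i) = g (dX i)) -> (forall i, f (dT i) = g (dT i)) -> f =1 g.
Proof.
move=> fx ft; apply: (@rmorph_malg_ext var dring) => -[i|i]; [exact: fx|exact: ft].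
Qed.

Lemma malgC_int (I : choiceType) (c : int) : c%:MP = c%:~R :> {malg int[cmonom I]}.
Proof. by rewrite -[c in LHS]intz rmorph_int. Qed.

Lemma dring_ind (Q : dring -> Prop) :
  (forall c : int, Q c%:~R) -> (forall p q, Q p -> Q q -> Q (p + q)) ->
  (forall i p, Q p -> Q (dX i * p)) -> (forall i p, Q p -> Q (dT i * p)) ->
  forall p, Q p.
Proof.
move=> Qc QD Qx Qt; apply: (@malg_cmonom_ind var) => [c|//|[i|i] p].
- by rewrite malgC_int; apply: Qc.
- exact: Qx.
- exact: Qt.
Qed.

Lemma dX_diff_lreg i j (p q : dring) : i != j ->
  (dX i - dX j) * p = (dX i - dX j) * q -> p = q.
Proof. by move=> ij; apply: (@var_diff_lreg var (inl i) (inl j)). Qed.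

Lemma dXT_diff_lreg i j (p q : dring) :
  (dX i - dT j) * p = (dX i - dT j) * q -> p = q.
Proof. exact: (@var_diff_lreg var (inl i) (inr j)). Qed.

Lemma substE s r (p : dpoly) :
  subst (fun v => match v with inl i => s i | inr i => r i end) p = dsub s r p.
Proof. by []. Qed.


(** * Polynomials in the t-variables and the Graham-positive cone *)

Lemma in_ZtD p q : in_Zt p -> in_Zt q -> in_Zt (p + q).
Proof.
move=> hp hq m /(fsubsetP (msuppD_le p q)); rewrite inE => /orP[/hp|/hq] h; exact: h.
Qed.

Lemma in_ZtM p q : in_Zt p -> in_Zt q -> in_Zt (p * q).
Proof.
move=> hp hq m /msuppM_le[k1 [k2 [h1 h2 ->]]] i.
by rewrite cmM (hp _ h1) (hq _ h2).
Qed.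

Lemma in_Zt_int (c : int) : in_Zt c%:~R.
Proof.
move=> m; rewrite -malgC_int => /(fsubsetP (msuppC_le c)); rewrite inE => /eqP -> i.
exact: cm1.
Qed.

Lemma in_Zt_T i : in_Zt (T i).
Proof. by move=> m; rewrite /T (msuppU1 _ (ucm _)) in_fset1 => /eqP -> j; apply: cmU. Qed.

Lemma in_Zt_at_tt p : in_Zt (at_tt p).
Proof.
have -> : at_tt p = dsub dT dT p by [].
move: p; apply: dring_ind => [c|p q hp hq|i p hp|i p hp].
- by rewrite rmorph_int; apply: in_Zt_int.
- by rewrite rmorphD; apply: in_ZtD.
- by rewrite rmorphM /= dsub_X; apply: in_ZtM => //; apply: in_Zt_T.
- by rewrite rmorphM /= dsub_T; apply: in_ZtM => //; apply: in_Zt_T.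
Qed.

(** Compared with the identity substitution monomial by monomial, the values of [s] never enter. *)
Lemma in_Zt_dsub (s : nat -> dring) p : in_Zt p -> dsub s dT p = p.
Proof.
move=> hp; transitivity (dsub dX dT p); last first.
  by apply: (dring_ext (g := idfun)) => i; [apply: dsub_X|apply: dsub_T].
have evalE s' : dsub s' dT p = \sum_(m <- msupp p) (p@_m)%:MP *
    \prod_(v <- finsupp m) (match v with inl i => s' i | inr i => dT i end) ^+ m v by [].
apply: etrans (evalE s) _; apply: etrans _ (esym (evalE dX)).
apply: eq_big_seq => m mp; apply: congr1.
apply: eq_big_seq => -[i|i]; last by [].
by rewrite -cmE_neq0 (hp _ mp).
Qed.

Definition graham_eval : {rmorphism {malg int[cmonom nat]} -> dring} :=
  @eval nat dring (@malgC (cmonom var) int) (fun k => dT k.+1 - dT k).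

Lemma graham_positiveP (c : dring) :
  graham_positive c <-> exists q, (forall m, 0 <= q@_m) /\ c = graham_eval q.
Proof. by []. Qed.

Lemma graham_positive0 : graham_positive 0.
Proof.
by apply/graham_positiveP; exists 0; split=> [m|]; rewrite ?mcoeff0 ?(rmorph0 graham_eval).
Qed.

Lemma graham_positive1 : graham_positive 1.
Proof.
apply/graham_positiveP; exists 1; split=> [m|]; last by rewrite (rmorph1 graham_eval).
by rewrite mcoeff1 ler0n.
Qed.

Lemma graham_positive_simple k : graham_positive (T k.+1 - T k).
Proof.
apply/graham_positiveP; exists << ucm k >>; split=> [m|].
  by rewrite mcoeffU1 ler0n.
by apply/esym; apply: (@eval_var nat dring).
Qed.

Lemma graham_positiveD (a b : dring) :
  graham_positive a -> graham_positive b -> graham_positive (a + b).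
Proof.
move=> /graham_positiveP[q [q0 ->]] /graham_positiveP[r [r0 ->]]; apply/graham_positiveP.
exists (q + r); split=> [m|]; last by rewrite (rmorphD graham_eval).
by rewrite mcoeffD addr_ge0.
Qed.

Lemma graham_positiveM (a b : dring) :
  graham_positive a -> graham_positive b -> graham_positive (a * b).
Proof.
move=> /graham_positiveP[q [q0 ->]] /graham_positiveP[r [r0 ->]]; apply/graham_positiveP.
exists (q * r); split=> [m|]; last by rewrite (rmorphM graham_eval).
rewrite mcoeffMl; apply: sumr_ge0 => k1 _; apply: sumr_ge0 => k2 _.
by apply: mulrn_wge0; apply: mulr_ge0.
Qed.

Lemma is_perm_inf_mul_s w i : is_perm_inf w -> is_perm_inf (mul_s w i).
Proof.
move=> /fsinjectiveP wi; apply/fsinjectiveP; apply: fscomp_inj wi.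
have sE k : s_ i k = swap i i.+1 k by rewrite !fsfun_withE fsfun0E.
by move=> k l; rewrite !sE /swap; do 4?case: eqP; lia.
Qed.

Lemma In_mem (F : forest) fs : List.In F fs <-> F \in fs.
Proof.
elim: fs => //= G gs [h1 h2]; rewrite inE; split=> [[->|/h1 ->]|/orP[/eqP ->|/h2]];
by rewrite ?eqxx ?orbT; auto.
Qed.

Lemma NoDup_uniq (fs : seq forest) : List.NoDup fs <-> uniq fs.
Proof.
elim: fs => [|F fs [h1 h2]] /=; first by split=> // _; apply: List.NoDup_nil.
split=> [/List.NoDup_cons_iff[nF /h1 ->]|/andP[nF /h2 u]].
  by rewrite andbT; apply/negP => /In_mem.
by apply: List.NoDup_cons => // /In_mem; apply/negP.
Qed.

Theorem theorem11p7 (S : perm_inf -> dpoly) (P : forest -> dpoly)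
  (HS : schubert_family S) (HP : forest_family P)
  (w : perm_inf) (Hw : is_perm_inf w) :
  (exists (fs : seq forest) (c : forest -> dpoly), expansion P (S w) fs c) /\
  (forall (fs : seq forest) (c : forest -> dpoly), expansion P (S w) fs c ->
     forall F, List.In F fs -> graham_positive (c F)).
Proof.
(* Including 0 closes this class under all simple divided differences. *)
pose Sch (p : dring) := p = 0 \/ exists2 v, is_perm_inf v & p = S v.
have swE i p : sw dX dT dsub i i.+1 p = swapx i p.
  rewrite /sw /sx /swapx substE; apply: (sub_ext dsub_X dsub_T dring_ext) => // j.
  by rewrite /swap; case: ifP => // _; case: ifP.
have P_ev F : canon F -> ev dT dsub id (P F) = (F == [::])%:R.
  by case/HP => _ h _; apply: etrans h _; case: F.
have P_trim F i : canon F -> Rp dX dT dsub i i (P F) - Rm dX dT dsub i i (P F) =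
    if i \in Qdes F then (dX i - dT i) * skip_t dX dT dsub i (P (fquot F i)) else 0.
  by case/HP => _ _ /(_ i); case: ifP => _ h; apply/esym.
have Sd p i : Sch p ->
    exists2 q, Sch q & (dX i - dX i.+1) * q = p - sw dX dT dsub i i.+1 p.
  case=> [->|[v pv ->]]; first by exists 0; [left|rewrite rmorph0 mulr0 subrr].
  rewrite swE; have [_ _ /(_ i)] := HS v pv; case: ifP => _ h.
    by exists (S (mul_s v i)) => //; right; exists (mul_s v i) => //; apply: is_perm_inf_mul_s.
  by exists 0; [left|rewrite mulr0].
have Sev p : Sch p -> graham_positive (ev dT dsub id p).
  case=> [->|[v pv ->]]; first by rewrite rmorph0; apply: graham_positive0.
  have [_ h _] := HS v pv; have -> : ev dT dsub id (S v) = at_tt (S v) by [].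
  by rewrite h; case: ifP => _; [apply: graham_positive1|apply: graham_positive0].
have Sw : Sch (S w) by right; exists w.
have [h1 h2] := graham_positive_expansion dsub_X dsub_T dring_ext dring_ind dX_diff_lreg
  dXT_diff_lreg P_ev P_trim graham_positive0 graham_positive1 graham_positive_simple
  graham_positiveD graham_positiveM Sd Sev Sw.
split.
  have [fs [c [ufs cfs hc e]]] := h1; exists fs, c; split=> //; first exact/NoDup_uniq.
  move=> F /In_mem Ffs; split; first exact: cfs.
  by have [q ->] := hc F; apply: in_Zt_at_tt.
move=> fs c [/NoDup_uniq ufs hfs e] F /In_mem Ffs; apply: (h2 fs c ufs _ e F Ffs).
by move=> G /In_mem/hfs[cG tG]; split=> // s; apply: in_Zt_dsub.
Qed.
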